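(* For the one-sample problem under known Hölder regularity (known $s > 0$, in dimension $d \ge 1$), there is a constant $c > 0$ depending only on $(s,d,L)$ such that $$R_\varepsilon^{(m)}(\mathcal{H}_s^d(L)) \ge \tfrac12, \quad \text{if } \varepsilon \le c\, m^{-2s/(4s+d)}.$$ Here $R_\varepsilon^{(m)}(\mathcal{H}_s^d(L))$ is the minimax risk for testing, from an i.i.d. sample of size $m$ with density $f$ on $[0,1]^d$, the hypothesis $f = f_0 \equiv 1$ against $f \in \mathcal{H}_s^d(L)$ with $\|f - f_0\|_2 \ge \varepsilon$.
   Context: Hölder class: for $s>0$, $\lfloor s \rfloor$ denotes the largest integer strictly smaller than $s$. For a constant $L$, $\mathcal{H}_s^d(L)$ is the class of functions $f:[0,1]^d \to \mathbb{R}$ having a derivative $f^{(\lfloor s\rfloor)}$ of order $\lfloor s \rfloor$ with $|f^{(\lfloor s \rfloor)}(x) - f^{(\lfloor s \rfloor)}(y)| \le L\|x-y\|^{s-\lfloor s\rfloor}$ for all $x,y\in[0,1]^d$, and such that $\|f^{(s')}\|_\infty \le L$ for all $s' \in \{0,\dots,\lfloor s\rfloor\}$. Here $f^{(k)}$ is the derivative of order $k$, with $f^{(0)} = f$. One-sample problem: $X_1,\dots,X_m$ are i.i.d. with density $f$ with respect to Lebesgue measure $\nu$ on $[0,1]^d$. A test $\phi$ is a Borel measurable function of the data with values in $[0,1]$, giving the probability of rejecting the null hypothesis. $\mathbb{E}_f^{(m)}$ denotes expectation when the sample has density $f$. Let $f_0 \equiv 1$ on $[0,1]^d$ (uniform density)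 and $\delta(f,g) = \|f-g\|_2 = (\int (f-g)^2\,d\nu)^{1/2}$. For a class $\mathcal{H}$ of functions and $\varepsilon > 0$, the worst-case risk of $\phi$ is $$R_\varepsilon^{(m)}(\phi;\mathcal{H}) = \mathbb{E}^{(m)}_{f_0}[\phi] + \sup\{\mathbb{E}^{(m)}_f[1-\phi] : f \in \mathcal{H},\ \delta(f,f_0) \ge \varepsilon\},$$ where $f$ is understood to be a probability density. The minimax risk is $R_\varepsilon^{(m)}(\mathcal{H}) = \inf_\phi R_\varepsilon^{(m)}(\phi;\mathcal{H})$, the infimum being over all tests.
   Formalization: The constant L is assumed to satisfy L > 1: for L ≤ 1 the only density the class can contain is the uniform one, so the alternative is empty for every ε > 0 and the test that never rejects has risk below 1/2. *)

(* Defs.v *)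
From HB Require Import structures.
From mathcomp Require Import all_boot all_order all_algebra.
From mathcomp Require Import all_classical all_reals all_analysis.

Set Implicit Arguments.
Unset Strict Implicit.
Unset Printing Implicit Defensive.
Import Order.TTheory GRing.Theory Num.Theory.
Import numFieldNormedType.Exports.

Local Open Scope classical_set_scope.
Local Open Scope ring_scope.

Section cons_measure.
Local Open Scope ereal_scope.
Context d (T : measurableType d) (R : realType) (n : nat).
Variable mu : {sigma_finite_measure set T -> \bar R}.
Variable M : {sigma_finite_measure set (n.-tuple T) -> \bar R}.

Definition tuple_cons (p : T * n.-tuple T) : n.+1.-tuple T :=
  [tuple of p.1 :: p.2].

Definition cons_measure : set (n.+1.-tuple T) -> \bar R :=
  pushforward (mu \x M) tuple_cons.

Lemma measurable_tuple_cons : measurable_fun setT tuple_cons.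
Proof. exact: measurable_cons. Qed.

Let measurable_preimage_cons (A : set (n.+1.-tuple T)) :
  measurable A -> measurable (tuple_cons @^-1` A).
Proof.
by move=> mA; rewrite -[X in measurable X]setTI; exact: measurable_tuple_cons.
Qed.

Let cons_measure0 : cons_measure set0 = 0.
Proof. by rewrite /cons_measure /pushforward preimage_set0 measure0. Qed.

Let cons_measure_ge0 A : 0 <= cons_measure A.
Proof. by rewrite /cons_measure /pushforward; exact: measure_ge0. Qed.

Let cons_measure_sigma_additive : semi_sigma_additive cons_measure.
Proof.
move=> F mF tF mUF; rewrite /cons_measure /pushforward preimage_bigcup.
apply: measure_semi_sigma_additive.
- by move=> k; exact: measurable_preimage_cons.
- apply/trivIsetP => /= i j _ _ ij; rewrite -preimage_setI.
  by move/trivIsetP : tF => /(_ _ _ _ _ ij) ->//; rewrite preimage_set0.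
- by rewrite -preimage_bigcup; exact: measurable_preimage_cons.
Qed.

HB.instance Definition _ := isMeasure.Build _ _ _ cons_measure
  cons_measure0 cons_measure_ge0 cons_measure_sigma_additive.

Let cons_measure_sigma_finite : sigma_finite setT cons_measure.
Proof.
have /sigma_finiteP[F [TF ndF Foo]] := sigma_finiteT mu.
have /sigma_finiteP[G [TG ndG Goo]] := sigma_finiteT M.
pose h (t : n.+1.-tuple T) := (thead t, [tuple of behead t]).
have mh : measurable_fun [set: n.+1.-tuple T] h.
  by apply/measurable_fun_pair; [exact: measurable_tnth|exact: measurable_behead].
have gK : cancel tuple_cons h.
  by case=> x t; rewrite /h /tuple_cons /= theadE; congr pair; apply/val_inj.
exists (fun k => h @^-1` (F k `*` G k)).
  apply/esym; rewrite -subTset => t _ /=.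
  have [k _ Fk] : (\bigcup_k F k) (h t).1 by rewrite -TF.
  have [l _ Gl] : (\bigcup_k G k) (h t).2 by rewrite -TG.
  exists (maxn k l) => //; split.
  - by move: Fk; exact/subsetPset/ndF/leq_maxl.
  - by move: Gl; exact/subsetPset/ndG/leq_maxr.
move=> k; have [mF Fk] := Foo k; have [mG Gk] := Goo k.
have mFG : measurable (F k `*` G k) by exact: measurableX.
split; first by rewrite -[X in measurable X]setTI; exact: mh.
rewrite /cons_measure /pushforward -comp_preimage.
rewrite (_ : h \o tuple_cons = id); last exact/funext.
by rewrite preimage_id product_measure1E// lte_mul_pinfty// ge0_fin_numE.
Qed.

HB.instance Definition _ := Measure_isSigmaFinite.Build _ _ _ cons_measure
  cons_measure_sigma_finite.

End cons_measure.

(* The n-fold product measure; on the one-point space of 0-tuples it is the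
   unit mass. *)
Fixpoint power_measure d (T : measurableType d) (R : realType)
    (mu : {sigma_finite_measure set T -> \bar R}) (n : nat) :
    {sigma_finite_measure set (n.-tuple T) -> \bar R} :=
  match n with
  | 0%N => @dirac _ (0.-tuple T) [tuple] R
  | n'.+1 => cons_measure mu (power_measure mu n')
  end.

Section calculus.
Context (R : realType) (d : nat).
Local Notation E := 'rV[R]_d.

(* The library's norm on matrices is the sup norm. *)
Definition enorm (x : E) : R := Num.sqrt (\sum_i x 0 i ^+ 2).

Definition cube : set E := [set x | forall i, 0 <= x 0 i <= 1].

(* A k-linear form on R^d is encoded as a function of sequences of vectors, of
   which only the values at sequences of size k matter. *)
Definition multilinear (k : nat) (A : seq E -> R) : Prop :=
  forall (u v : seq E) (a : R) (x y : E), (size u + size v).+1 = k ->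
    A (u ++ (a *: x + y) :: v) = a * A (u ++ x :: v) + A (u ++ y :: v).

Definition opnorm (k : nat) (A : seq E -> R) : \bar R :=
  ereal_sup [set `|A v|%:E | v in
    [set v : seq E | size v = k /\ {in v, forall x, enorm x <= 1}]].

(* At the boundary of the cube the limit is taken along the cube only; the
   derivative is still unique. *)
Definition is_frechet_derivative (k : nat) (F F' : E -> seq E -> R) (x : E) :=
  forall e : R, 0 < e ->
    \forall y \near within cube (nbhs x),
      (opnorm k (fun v => F y v - F x v - F' x ((y - x) :: v))%R
       <= (e * enorm (y - x))%:E)%E.

(* [D j x] is the derivative of order j of f at x, as a j-linear form. *)
Definition derivatives (k : nat) (f : E -> R) (D : nat -> E -> seq E -> R) :=
  [/\ forall x, cube x -> D 0%N x [::] = f x,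
      forall j x, (j <= k)%N -> cube x -> multilinear j (D j x) &
      forall j x, (j < k)%N -> cube x ->
        is_frechet_derivative j (D j) (D j.+1) x].

(* The largest integer strictly smaller than s, for s > 0. *)
Definition sfloor (s : R) : nat := `|Num.ceil s - 1|%N.

Definition holder (s L : R) : set (E -> R) :=
  [set f | exists D : nat -> E -> seq E -> R,
    [/\ derivatives (sfloor s) f D,
        forall x y, cube x -> cube y ->
          (opnorm (sfloor s) (fun v => D (sfloor s) x v - D (sfloor s) y v)%R
           <= (L * enorm (x - y) `^ (s - (sfloor s)%:R))%R%:E)%E &
        forall j x, (j <= sfloor s)%N -> cube x ->
          (opnorm j (D j x) <= L%:E)%E]].

End calculus.

Section testing.
Context (R : realType) (d : nat).
Local Open Scope ereal_scope.
Local Notation E := 'rV[R]_d.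
(* R^d with its product Borel sigma-algebra, which the library puts on tuples
   rather than on row vectors. *)
Local Notation pt := (d.-tuple (measurableTypeR R)).

Definition vec (x : pt) : E := \row_i tnth x i.

Definition ptcube : set pt := vec @^-1` @cube R d.

Definition nu : {sigma_finite_measure set pt -> \bar R} :=
  power_measure (@lebesgue_measure R) d.

Definition is_density (f : E -> R) : Prop :=
  [/\ measurable_fun ptcube (f \o vec),
      forall x, cube x -> (0 <= f x)%R &
      \int[nu]_(x in ptcube) (f (vec x))%:E = 1].

Definition L2dist (f g : E -> R) : \bar R :=
  (\int[nu]_(x in ptcube) ((f (vec x) - g (vec x)) ^+ 2)%:E) `^ (2^-1).

Definition f0 : E -> R := cst 1%R.

Definition is_test (m : nat) (phi : m.-tuple pt -> R) : Prop :=
  measurable_fun setT phi /\ forall x, (0 <= phi x <= 1)%R.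

(* Expectation of g(X_1, ..., X_m) when X_1, ..., X_m are i.i.d. with density
   f, whose joint density is the product of the f(x_i). *)
Definition expect (m : nat) (f : E -> R) (g : m.-tuple pt -> R) : \bar R :=
  \int[power_measure nu m]_(x in [set x | forall i, ptcube (tnth x i)])
    (g x * \prod_(i < m) f (vec (tnth x i)))%:E.

(* The supremum is in the extended reals: an empty alternative gives -oo. *)
Definition risk (m : nat) (H : set (E -> R)) (eps : R)
    (phi : m.-tuple pt -> R) : \bar R :=
  expect f0 phi +
  ereal_sup [set expect f (fun x => 1 - phi x)%R | f in
    [set f | [/\ H f, is_density f & eps%:E <= L2dist f f0]]].

Definition minimax_risk (m : nat) (H : set (E -> R)) (eps : R) : \bar R :=
  ereal_inf [set risk H eps phi | phi in [set phi | @is_test m phi]].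

End testing.

(* Main.v *)
From HB Require Import structures.
From mathcomp Require Import all_boot all_order all_algebra.
From mathcomp Require Import all_classical all_reals all_analysis.
From mathcomp Require Import measurable_realfun ring lra.
Require Import Defs.

Set Implicit Arguments.
Unset Strict Implicit.
Unset Printing Implicit Defensive.
Import Order.TTheory GRing.Theory Num.Theory.
Import numFieldNormedType.Exports.
Local Open Scope classical_set_scope.
Local Open Scope ring_scope.

(** The argument is Ingster's: the uniform density is compared with a mixture
of alternatives, and the mixture is indistinguishable from it as soon as its
chi-square divergence is small.

Cut the cube into n^d cells and put on each cell k a smooth bump h_k of
integral zero, a product of rescaled one-dimensional bumps. For a vector u of
signs indexed by the cells, the alternative is 1 + gam * sum_k u_k h_k with
gam = c1 n^-s. Since the bumps live on disjoint cells, only one of them is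
nonzero at a given point; hence the derivatives of order j of the alternative
are of size gam n^j, uniformly in u and n. As j <= s, this keeps the
alternative in the Hoelder ball ([alt_holder]) and nonnegative
([alt_density]). Its L2 distance to 1 is of order gam ([alt_separated]).

For one sample, the product of the alternatives of signs u and w has integral
1 + gam^2 sum_k u_k w_k int h_k^2 ([alt_mul_int]), so over m samples it has the
m-th power of that, by Fubini ([box_integral]). Averaging over independent
uniform signs and using 1 + y <= exp y leaves a product over the cells of terms
cosh(m gam^2 int h_k^2) ([rademacher_second_moment]). Each int h_k^2 is of
order n^-d, so the average is close to 1 when n^d (m gam^2 n^-d)^2, that is
m^2 n^(-4s-d) up to a constant, is small. The choice of n of order
m^(2/(4s+d)) achieves this ([grid_calibration], [alt_chi2]), and then
gam is of order m^(-2s/(4s+d)), which is the rate.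

Finally, if the second moment of the likelihood ratio of the mixture is at most
5/4, the risk of every test averaged over the signs is at least 1/2, and some
sign vector does at least as badly as the average
([mixture_second_moment]).

The Hoelder condition, which asks for derivatives as multilinear forms, is
reduced to one variable: a family of functions indexed by lists of coordinates,
each having the next ones as partial derivatives along every line, gives all
the required estimates by the mean value theorem ([holder_of_jet]). *)

(** * A compactly supported bump with integral zero *)

Section glue.
Context (R : realType).
Implicit Types f g : R -> R.

Definition glue (a : R) f g (t : R) : R := if t <= a then f t else g t.

(** Away from [a] the glued function locally is one of the two pieces. At [a],
Caratheodory's criterion applies: each piece has a continuous difference
quotient, and the two quotients agree at [a], so their gluing is a continuous
quotient. *)
Lemma is_derive_glue a f g f' g' :
  (forall t : R, is_derive t (1 : R) f (f' t)) ->
  (forall t : R, is_derive t (1 : R) g (g' t)) ->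
  f a = g a -> f' a = g' a ->
  forall t : R, is_derive t (1 : R) (glue a f g) (glue a f' g' t).
Proof.
move=> df dg fga fga' t; rewrite {2}/glue; case: (ltgtP t a) => [ta|ta|->].
- apply: (near_eq_is_derive _ (df t)).
  near=> x; rewrite /glue ifT//; near: x.
  by exact: lt_le_nbhsl.
- apply: (near_eq_is_derive _ (dg t)).
  near=> x; rewrite /glue leNgt ifF//; apply/negbF; near: x.
  exact: lt_nbhsr.
- have [u [fu uc ua]] := (is_derive1_caratheodory f a (f' a)).1 (df a).
  have [v [gv vc va]] := (is_derive1_caratheodory g a (g' a)).1 (dg a).
  apply/is_derive1_caratheodory; exists (glue a u v); split.
  + by move=> z; rewrite /glue lexx; case: ifP => _ //; rewrite fga.
  + apply/cvgrPdist_lt => e e0; near=> x; rewrite {1}/glue lexx /glue.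
    case: ifP => _; near: x.
      by move/cvgrPdist_lt : uc; exact.
    by move/cvgrPdist_lt : vc => /(_ e e0); rewrite va -fga' -ua.
  + by rewrite /glue lexx.
Unshelve. all: by end_near. Qed.
End glue.

Section bump.
Context (R : realType).

(** The power [Q] makes this derivative of order [n] vanish at 0 and 1 as long
as [n < Q], which is what lets it be continued by zero. *)
Definition arch (Q n : nat) : {poly R} := (('X * (1 - 'X)) ^+ Q)^`(n).

(** For [n < Q], this is the derivative of order [n] of [bump Q 0]. The perturbations
are built on [bump Q 1] and not on [bump Q 0]: being the derivative of a
function with compact support, it has integral zero. *)
Definition bump (Q n : nat) : R -> R :=
  glue 0 (cst 0) (glue 1 (horner (arch Q n)) (cst 0)).

(** Each derivation costs one power of X(1 - X). *)
Lemma arch_dvd Q n : (n <= Q)%N ->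
  exists q, arch Q n = ('X * (1 - 'X)) ^+ (Q - n) * q.
Proof.
rewrite /arch; elim: n => [|n IHn] nQ; first by exists 1; rewrite subn0 mulr1.
have [q qE] := IHn (ltnW nQ); rewrite derivnS qE derivM deriv_exp.
rewrite -[(Q - n)%N](subnSK nQ) exprS /=.
set w := 'X * _; exists (q * w^`() *+ (Q - n.+1).+1 + w * q^`()).
by ring.
Qed.

Lemma arch0 Q n t : (n < Q)%N -> t = 0 \/ t = 1 -> (arch Q n).[t] = 0.
Proof.
move=> nQ t01; have [q ->] := arch_dvd (ltnW nQ).
rewrite hornerM horner_exp !hornerE.
have -> : t * (1 - t) = 0 by case: t01 => ->; rewrite ?subrr ?mul0r ?mulr0.
by rewrite expr0n subn_eq0 leqNgt nQ mul0r.
Qed.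

Lemma bump_is_derive Q n (t : R) : (n.+1 < Q)%N ->
  is_derive t (1 : R) (bump Q n) (bump Q n.+1 t).
Proof.
move=> nQ; apply: (@is_derive_glue _ 0 _ _ (cst 0)).
- apply: (@is_derive_glue _ 1 _ _ (horner (arch Q n.+1)) (cst 0)).
  + by rewrite arch0//; [exact: ltnW|right].
  + by rewrite arch0//; right.
- by rewrite /glue ler01 arch0//; [exact: ltnW|left].
- by rewrite /glue ler01 arch0//; left.
Qed.

Lemma bump_eq0 Q n t : (n < Q)%N -> ~~ (0 < t < 1) -> bump Q n t = 0.
Proof.
move=> nQ; rewrite /bump /glue; case: (ltgtP t 0) => //= t0.
by case: (ltgtP t 1) => //= -> _; rewrite arch0//; right.
Qed.

Lemma bump_bounded Q : exists2 B, 1 <= B &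
  forall n t, (n <= Q)%N -> `|bump Q n t| <= B.
Proof.
pose M n := \sum_(i < size (arch Q n)) `|(arch Q n)`_i|.
exists (1 + \sum_(n < Q.+1) M n) => [|n t nQ].
  by rewrite lerDl sumr_ge0// => n _; exact: sumr_ge0.
have M0 k : 0 <= M k by exact: sumr_ge0.
have : `|bump Q n t| <= M n.
  rewrite /bump /glue; case: ifPn => [_|]; first by rewrite normr0.
  rewrite -ltNge => t0; case: ifPn => t1; last by rewrite normr0.
  rewrite horner_coef (le_trans (ler_norm_sum _ _ _))// ler_sum// => i _.
  by rewrite normrM normrX ler_piMr// exprn_ile1// gtr0_norm// ltW.
move=> /le_trans; apply; rewrite -[leLHS]add0r lerD//.
by rewrite (bigD1 (Ordinal (nQ : (n < Q.+1)%N)))//= lerDl sumr_ge0.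
Qed.

(** On this interval the slope Q (t(1-t))^(Q-1) (1-2t) stays away from 0. The
bound only serves to make the integral of the squared bump positive, uniformly
in the grid. *)
Lemma bump1_ge Q t : (0 < Q)%N -> 8^-1 <= t <= 4^-1 ->
  (16^-1) ^+ Q <= bump Q 1 t.
Proof.
move=> Q0 /andP[t8 t4]; have t0 : 0 < t by apply: lt_le_trans t8.
have t1 : t <= 1 by apply: (le_trans t4); lra.
rewrite /bump /glue [t <= 0]leNgt t0 /= t1 /arch /= deriv_exp.
rewrite hornerMn hornerM horner_exp.
rewrite !hornerE/= derivM derivB derivX derivC !hornerE.
case: Q Q0 => // Q _ /=; rewrite exprS -[leRHS]mulr_natr.
have w : 16^-1 <= t * (1 - t) by nra.
have h : 16^-1 ^+ Q <= (t * (1 - t)) ^+ Q by rewrite lerXn2r// nnegrE; lra.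
have g0 : 0 <= (16^-1 : R) ^+ Q by rewrite exprn_ge0.
have h2 : 16^-1 * 16^-1 ^+ Q <= (1 - t + t * -1) * (t * (1 - t)) ^+ Q.
  by apply: ler_pM => //; lra.
apply: (le_trans h2); rewrite -[leLHS]mulr1 ler_pM2l ?(ler_nat _ 1)//.
by rewrite mulr_gt0 ?exprn_gt0//; [lra|nra].
Qed.

End bump.

(** * Integrals of the bump over a cell *)

Section bump_integral.
Context (R : realType).
Local Notation leb := (@lebesgue_measure R).
Implicit Types Q n K j : nat.

Lemma is_derive_affine (f : R -> R) (a b t df : R) :
  is_derive (a * t + b) (1 : R) f df ->
  is_derive t (1 : R) (fun t => f (a * t + b)) (a * df).
Proof.
move=> fd; have -> : (fun t => f (a * t + b)) = f \o (fun t => a * t + b) by [].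
rewrite mulrC; apply: is_derive1_comp.
have := @is_deriveD _ _ _ (a \*: id) (cst b) t (1 : R) (a *: 1) 0
  (@is_deriveZ _ _ _ _ _ _ _ _ _) _.
by rewrite addr0 [a *: _]mulr1; apply.
Qed.

Lemma is_derive_continuous (f f' : R -> R) :
  (forall t : R, is_derive t (1 : R) f (f' t)) -> continuous f.
Proof.
by move=> fd t; apply/differentiable_continuous/derivable1_diffP; case: (fd t).
Qed.

Lemma bump_affine_continuous Q n (a b : R) : (n.+1 < Q)%N ->
  continuous (fun t => bump Q n (a * t + b)).
Proof.
move=> nQ; apply: (@is_derive_continuous _ (fun t => a * bump Q n.+1 (a * t + b))).
by move=> t; apply: is_derive_affine; exact: bump_is_derive.
Qed.

(** The primitive is [bump Q 0], rescaled, and it vanishes at 0 and at 1 because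
the cell lies in the unit interval. *)
Lemma bump_cell_int0 Q K j : (2 < Q)%N -> (j < K)%N ->
  \int[leb]_(t in `[0, 1]) bump Q 1 (K%:R * t - j%:R) = 0.
Proof.
move=> Q2 jK; have K0 : 0 < K%:R :> R by rewrite ltr0n (leq_trans _ jK).
pose F t : R := K%:R^-1 * bump Q 0 (K%:R * t - j%:R).
have dF (t : R) : is_derive t (1 : R) F (bump Q 1 (K%:R * t - j%:R)).
  have h : is_derive t (1 : R) (fun t => bump Q 0 (K%:R * t + - j%:R))
      (K%:R * bump Q 1 (K%:R * t - j%:R)).
    by apply: is_derive_affine; apply: bump_is_derive; exact: ltnW.
  have := @is_deriveZ _ _ _ _ K%:R^-1 _ _ _ h.
  by rewrite /GRing.scale /= mulKf// gt_eqF.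
have cF := is_derive_continuous dF.
rewrite /Rintegral (@continuous_FTC2 _ _ F)//.
- have jK1 : j%:R + 1 <= K%:R :> R by rewrite natr1 ler_nat.
  have j0 : 0 <= j%:R :> R by [].
  rewrite /F !(@bump_eq0 _ Q 0) ?mulr0 ?subrr ?(ltn_trans _ Q2)//=.
  + by rewrite subrr.
  + by apply/negP => /andP[]; lra.
  + by apply/negP => /andP[]; lra.
- by apply: continuous_subspaceT; exact: bump_affine_continuous.
- split.
  + by move=> t _; case: (dF t).
  + by apply: cvg_at_right_filter; exact: cF.
  + by apply: cvg_at_left_filter; exact: cF.
- by move=> t _; rewrite derive1E; case: (dF t).
Qed.

Lemma continuous_itv_integrable (f : R -> R) (a b : R) : continuous f ->
  leb.-integrable `[a, b] (EFin \o f).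
Proof.
move=> cf; apply: continuous_compact_integrable; first exact: segment_compact.
exact: continuous_subspaceT.
Qed.

Lemma bump_cell_sqr_continuous Q n K j : (n.+1 < Q)%N ->
  continuous (fun t : R => bump Q n (K%:R * t - j%:R) ^+ 2).
Proof.
move=> Q2 t; rewrite /continuous_at expr2; under eq_fun do rewrite expr2.
by apply: cvgM; exact: bump_affine_continuous.
Qed.

Lemma cell_measure (K j : nat) (a b : R) : (0 < K)%N -> a <= b ->
  fine (leb `[(j%:R + a) / K%:R, (j%:R + b) / K%:R]) = (b - a) / K%:R.
Proof.
move=> K0 ab; rewrite lebesgue_measure_itv /= lte_fin.
have K1 : 0 < K%:R^-1 :> R by rewrite invr_gt0 ltr0n.
rewrite ltr_pM2r// ltrD2l; case: ltgtP ab => //= [ab _|-> _]; last first.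
  by rewrite subrr mul0r.
by rewrite -mulrBl; congr (_ / _); ring.
Qed.

Lemma mem_cell (K j : nat) (a b t : R) : (0 < K)%N ->
  `[(j%:R + a) / K%:R, (j%:R + b) / K%:R]%classic t <-> a <= K%:R * t - j%:R <= b.
Proof.
move=> K0; have K1 : 0 < K%:R :> R by rewrite ltr0n.
rewrite /= in_itv /= ler_pdivrMr// ler_pdivlMr//.
by rewrite lerBrDl lerBlDl [t * _]mulrC.
Qed.

Lemma cell_subset (K j : nat) (a b : R) : (j < K)%N -> 0 <= a -> b <= 1 ->
  `[(j%:R + a) / K%:R, (j%:R + b) / K%:R] `<=` (`[0, 1] : set R).
Proof.
move=> jK a0 b1 t; have K0 : (0 < K)%N by exact: leq_trans jK.
have K1 : 0 < K%:R :> R by rewrite ltr0n.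
move=> /(mem_cell _ _ _ _ K0) /andP[h1 h2]; rewrite /= in_itv /=.
have j0 : 0 <= j%:R :> R by [].
have jK' : j%:R + 1 <= K%:R :> R by rewrite natr1 ler_nat.
by apply/andP; split; rewrite -(ler_pM2l K1); lra.
Qed.

Lemma bump_cell_int2_le Q K j (B : R) : (2 < Q)%N -> (j < K)%N ->
  (forall t : R, `|bump Q 1 t| <= B) ->
  \int[leb]_(t in `[0, 1]) bump Q 1 (K%:R * t - j%:R) ^+ 2 <= B ^+ 2 / K%:R.
Proof.
move=> Q2 jK BB; have K0 : (0 < K)%N by exact: leq_trans jK.
pose f (t : R) : R := bump Q 1 (K%:R * t - j%:R) ^+ 2.
have cf : continuous f by exact: bump_cell_sqr_continuous.
pose I : set R := `[(j%:R + 0) / K%:R, (j%:R + 1) / K%:R]%classic.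
have mI : measurable (I : set (measurableTypeR R)) by exact: measurable_itv.
have fI : f = f \_ I.
  apply/funext => t; rewrite patchE; case: ifPn => // /negP tI.
  rewrite /f bump_eq0 ?expr0n//; first exact: ltn_trans Q2.
  apply/negP => /andP[h1 h2]; apply: tI; rewrite inE.
  by apply/mem_cell => //; rewrite !ltW.
rewrite -[X in Rintegral _ _ X]/f fI -Rintegral_mkcondr setIidr; last first.
  exact: cell_subset.
have B0 := le_trans (normr_ge0 _) (BB 0).
apply: (@le_trans _ _ (\int[leb]_(t in I) (B ^+ 2))).
  apply: le_Rintegral => //; [exact: continuous_itv_integrable| |].
    by apply: continuous_itv_integrable => t; exact: cst_continuous.
  by move=> t _; rewrite /f -real_normK ?num_real// lerXn2r ?nnegrE.
by rewrite Rintegral_cst// cell_measure// subr0 mul1r.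
Qed.

Lemma bump_cell_int2_ge Q K j : (2 < Q)%N -> (j < K)%N ->
  (16^-1) ^+ Q ^+ 2 / 8 / K%:R <=
  \int[leb]_(t in `[0, 1]) bump Q 1 (K%:R * t - j%:R) ^+ 2.
Proof.
move=> Q2 jK; have K0 : (0 < K)%N by exact: leq_trans jK.
pose f (t : R) : R := bump Q 1 (K%:R * t - j%:R) ^+ 2.
have cf : continuous f by exact: bump_cell_sqr_continuous.
pose I : set R := `[(j%:R + 8^-1) / K%:R, (j%:R + 4^-1) / K%:R]%classic.
have mI : measurable (I : set (measurableTypeR R)) by exact: measurable_itv.
set c := 16^-1 ^+ Q ^+ 2.
have c0 : 0 <= c by rewrite sqr_ge0.
apply: (@le_trans _ _ (\int[leb]_(t in `[0, 1]) ((cst c) \_ I) t)).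
  rewrite -Rintegral_mkcondr setIidr; last by apply: cell_subset => //; lra.
  rewrite Rintegral_cst// cell_measure//; last lra.
  by rewrite -mulrA (_ : 4^-1 - 8^-1 = 8^-1)//; lra.
apply: le_Rintegral => //.
- rewrite -restrict_EFin; apply/integrable_restrict => //=.
  rewrite setIidr; last by apply: cell_subset => //; lra.
  by apply: continuous_itv_integrable => t; exact: cst_continuous.
- exact: continuous_itv_integrable.
- move=> t _; rewrite patchE; case: ifPn => [|_]; last exact: sqr_ge0.
  rewrite inE => /(mem_cell _ _ _ _ K0) h; rewrite /= /c /f.
  have := bump1_ge (ltnW (ltnW Q2)) h; have : 0 <= (16^-1 : R) ^+ Q by [].
  by move=> p0 p1; rewrite lerXn2r// nnegrE (le_trans p0).
Qed.

End bump_integral.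

(** * Integrals of products of functions of separate coordinates *)

Section product_integral.
Context d (T : measurableType d) (R : realType).
Variable mu : {sigma_finite_measure set T -> \bar R}.

(** Fubini for a product of integrable functions of one variable each; the
integrability of the product comes with it, from Tonelli. *)
Lemma product_integral d2 (U : measurableType d2)
  (M : {sigma_finite_measure set U -> \bar R}) (f : T -> R) (g : U -> R) :
  mu.-integrable setT (EFin \o f) -> M.-integrable setT (EFin \o g) ->
  (mu \x M)%E.-integrable setT (fun p => (f p.1 * g p.2)%:E) /\
  (\int[(mu \x M)%E]_p (f p.1 * g p.2))%R = (\int[mu]_x f x) * (\int[M]_y g y).
Proof.
move=> fi gi.
have mf : measurable_fun setT f by apply/measurable_EFinP; case/integrableP : fi.
have mg : measurable_fun setT g by apply/measurable_EFinP; case/integrableP : gi.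
have mh : measurable_fun setT (fun p : T * U => (f p.1 * g p.2)%:E).
  apply/measurable_EFinP; apply: measurable_funM.
    by apply: measurableT_comp => //; exact: measurable_fst.
  by apply: measurableT_comp => //; exact: measurable_snd.
have hi : (mu \x M)%E.-integrable setT (fun p => (f p.1 * g p.2)%:E).
  apply/integrable12ltyP => //=.
  have ag : (\int[M]_y `|(g y)%:E| < +oo)%E by case/integrableP : gi.
  rewrite (_ : (fun x => _) =
      fun x => ((fine (\int[M]_y `|(g y)%:E|))%:E * `|(f x)%:E|)%E); last first.
    apply/funext => x; rewrite fineK ?ge0_fin_numE ?integral_ge0//.
    rewrite muleC -ge0_integralZl//; last first.
      by apply: measurableT_comp => //; exact/measurable_EFinP.
    by apply: eq_integral => y _; rewrite /= normrM.
  rewrite (@ge0_integralZl_EFin _ _ _ mu setT _ (fun x => `|(f x)%:E|%E))//.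
  all: try by rewrite fine_ge0// integral_ge0.
  all: try by do 2 (apply: measurableT_comp => //).
  case/integrableP : fi => _ fi; rewrite lte_mul_pinfty// lee_fin.
  by rewrite fine_ge0// integral_ge0.
split => //.
rewrite {1}/Rintegral -integral12_prod_meas1//.
have Gf := integrable_fin_num measurableT gi.
have Ff := integrable_fin_num measurableT fi.
rewrite /fubini_F; rewrite (_ : (fun x => _) =
    fun x => ((\int[M]_y (g y)%:E) * (f x)%:E)%E); last first.
  by apply/funext => x; rewrite muleC -integralZl//.
have := Gf; rewrite /comp => /fineK <-.
by rewrite integralZl// fineM//= mulrC.
Qed.

Lemma power_measure_integral n (g : 'I_n -> T -> R) :
  (forall i, mu.-integrable setT (EFin \o g i)) ->
  (power_measure mu n).-integrable setT
    (EFin \o (fun x => \prod_(i < n) g i (tnth x i))) /\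
  \int[power_measure mu n]_x (\prod_(i < n) g i (tnth x i)) =
  \prod_(i < n) \int[mu]_x g i x.
Proof.
elim: n g => [|n IHn] g gi.
  have E : (fun x : 0.-tuple T => \prod_(i < 0) g i (tnth x i)) = cst 1.
    by apply/funext => x; rewrite big_ord0.
  rewrite E big_ord0; split.
    by apply: finite_measure_integrable_cst.
  rewrite Rintegral_cst// mul1r.
  exact: (congr1 fine (diracT R ([tuple] : 0.-tuple T))).
have [pi pE] := IHn _ (fun i => gi (lift ord0 i)).
have [hi hE] := product_integral (gi ord0) pi.
set G := fun x => _.
have mg i : measurable_fun setT (g i).
  by apply/measurable_EFinP; case/integrableP : (gi i).
have mG : measurable_fun setT (EFin \o G).
  apply/measurable_EFinP; apply: measurable_prod => i _.
  by apply: measurableT_comp => //; exact: measurable_tnth.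
have GE : EFin \o G \o @tuple_cons _ T n =
    fun p => (g ord0 p.1 * \prod_(i < n) g (lift ord0 i) (tnth p.2 i))%:E.
  apply/funext => -[x t]; rewrite /G /= big_ord_recl; congr (_ * _)%:E.
  by apply: eq_bigr => i _; rewrite tnthS.
have mc := @measurable_tuple_cons _ T n.
rewrite big_ord_recl -pE -hE; split.
  by apply: (integrable_pushforward mc) => //; rewrite preimage_setT GE.
rewrite /Rintegral; congr fine.
rewrite (@integral_pushforward _ _ _ _ _ _ mc _ setT (EFin \o G))//.
  by rewrite preimage_setT GE.
by rewrite preimage_setT GE.
Qed.

End product_integral.

Definition box (T : Type) (A : set T) n : set (n.-tuple T) :=
  [set x | forall i, A (tnth x i)].
Arguments box {T} A n _.

Section box_integral.
Context d (T : measurableType d) (R : realType).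
Variable mu : {sigma_finite_measure set T -> \bar R}.

Lemma measurable_box (A : set T) n : measurable A -> measurable (box A n).
Proof.
move=> mA; have -> : box A n =
    \bigcap_(i in [set: 'I_n]) ((fun x : n.-tuple T => tnth x i) @^-1` A).
  by apply/seteqP; split => [x xA i _|x xA i]; apply: xA.
apply: fin_bigcap_measurable => // i _; rewrite -[X in measurable X]setTI.
exact: measurable_tnth.
Qed.

(** Restricting to a box is restricting each factor, which reduces integrals over
a box to integrals over the whole space. *)
Lemma restrict_prod (A : set T) n (g : 'I_n -> T -> R) :
  (fun x : n.-tuple T => \prod_(i < n) (g i \_ A) (tnth x i)) =
  (fun x => \prod_(i < n) g i (tnth x i)) \_ (box A n).
Proof.
apply/funext => x; rewrite patchE; case: ifPn => [|/negP xA].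
  by rewrite inE => xA; apply: eq_bigr => i _; rewrite patchE mem_set.
have [i iA] : exists i, ~ A (tnth x i).
  by apply/existsNP => h; apply: xA; rewrite inE.
by rewrite (bigD1 i)//= patchE memNset// mul0r.
Qed.

Lemma box_integral (A : set T) n (g : 'I_n -> T -> R) : measurable A ->
  (forall i, mu.-integrable A (EFin \o g i)) ->
  (power_measure mu n).-integrable (box A n)
    (EFin \o (fun x => \prod_(i < n) g i (tnth x i))) /\
  \int[power_measure mu n]_(x in box A n) (\prod_(i < n) g i (tnth x i)) =
  \prod_(i < n) \int[mu]_(x in A) g i x.
Proof.
move=> mA gi; have mB := @measurable_box A n mA.
have gi' i : mu.-integrable setT (EFin \o (g i \_ A)).
  by rewrite -restrict_EFin; exact: (integrable_mkcond _ mA).1.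
have [pi pE] := power_measure_integral gi'; split.
  by apply: (integrable_mkcond _ mB).2; rewrite restrict_EFin -restrict_prod.
rewrite Rintegral_mkcond -restrict_prod pE.
by apply: eq_bigr => i _; rewrite -Rintegral_mkcond.
Qed.

End box_integral.

Section Rintegral_sum.
Context d (T : measurableType d) (R : realType).
Variables (mu : {measure set T -> \bar R}) (D : set T) (mD : measurable D).

Lemma Rintegral_sum (I : finType) (F : I -> T -> R) :
  (forall i, mu.-integrable D (EFin \o F i)) ->
  mu.-integrable D (EFin \o (fun x => \sum_i F i x)) /\
  \int[mu]_(x in D) (\sum_i F i x) = \sum_i \int[mu]_(x in D) F i x.
Proof.
move=> iF; have h (s : seq I) :
  mu.-integrable D (EFin \o (fun x => \sum_(i <- s) F i x)) /\
  \int[mu]_(x in D) (\sum_(i <- s) F i x) = \sum_(i <- s) \int[mu]_(x in D) F i x.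
  elim: s => [|i s [IH1 IH2]].
    have E : (fun x : T => \sum_(i <- [::]) F i x) = cst 0.
      by apply/funext => x; rewrite big_nil.
    by rewrite E big_nil Rintegral_cst// mul0r; split=> //; exact: integrable0.
  have E : (fun x : T => \sum_(j <- i :: s) F j x) =
      (fun x => F i x + \sum_(j <- s) F j x).
    by apply/funext => x; rewrite big_cons.
  rewrite E big_cons -IH2; split; last exact: RintegralD.
  have := integrableD mD (iF i) IH1.
  by apply: eq_integrable => // x _; rewrite /= EFinD.
exact: h.
Qed.

Lemma integrableZlR (r : R) (f : T -> R) : mu.-integrable D (EFin \o f) ->
  mu.-integrable D (EFin \o (fun x => r * f x)).
Proof.
by move=> /(integrableZl mD r); apply: eq_integrable => // x _; rewrite /= EFinM.
Qed.

Lemma integrableDR (f g : T -> R) : mu.-integrable D (EFin \o f) ->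
  mu.-integrable D (EFin \o g) ->
  mu.-integrable D (EFin \o (fun x => f x + g x)).
Proof.
move=> fi gi; have := integrableD mD fi gi.
by apply: eq_integrable => // x _; rewrite /= EFinD.
Qed.

End Rintegral_sum.

(** * From second moments to a lower bound on the risk *)

Lemma bounded_integrable d (T : measurableType d) (R : realType)
    (mu : {measure set T -> \bar R}) (A : set T) (f : T -> R) (B : R) :
  measurable A -> (mu A < +oo)%E -> measurable_fun A f ->
  (forall x, A x -> `|f x| <= B) -> mu.-integrable A (EFin \o f).
Proof.
move=> mA Aoo mf fB; apply: measurable_bounded_integrable => //.
exists B; split; first exact: num_real.
by move=> x Bx y Ay; apply: le_trans (fB y Ay) (ltW Bx).
Qed.

Section mixture.
Context d (T : measurableType d) (R : realType).
Variable mu : {sigma_finite_measure set T -> \bar R}.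
Variables (A : set T) (mA : measurable A) (A1 : mu A = 1%E).

(** Let L be the average over [i] of the likelihoods, that is the likelihood
ratio of the mixture against the constant density 1. For a test with values in
[0,1], phi + (1 - phi) L >= -1/4 + 2 L - L^2 pointwise, because the difference
is phi (1 - L) + (L - 1/2)^2. As L has integral 1, the error averaged over [i]
is at least 7/4 minus the integral of L^2, hence at least 1/2 if that integral
is at most 5/4; some [i] reaches the average. *)
Lemma mixture_second_moment (I : finType) (i0 : I) (f : I -> T -> R) (B : R)
    (m : nat) (phi : m.-tuple T -> R) :
  (forall i, measurable_fun A (f i)) ->
  (forall i x, A x -> 0 <= f i x <= B) ->
  (forall i, \int[mu]_(x in A) f i x = 1) ->
  \sum_i \sum_j (\int[mu]_(x in A) (f i x * f j x)) ^+ m <=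
    5 / 4 * #|I|%:R ^+ 2 ->
  measurable_fun setT phi -> (forall x, 0 <= phi x <= 1) ->
  exists i, ((2^-1)%:E <= \int[power_measure mu m]_(x in box A m) (phi x)%:E +
    \int[power_measure mu m]_(x in box A m)
      ((1 - phi x) * \prod_(a < m) f i (tnth x a))%:E)%E.
Proof.
move=> mf fB f1 chi mphi phi01.
have mB := @measurable_box _ _ A m mA.
set M := power_measure mu m.
pose P i (x : m.-tuple T) := \prod_(a < m) f i (tnth x a).
pose N : R := #|I|%:R.
have N0 : 0 < N by rewrite ltr0n; apply/card_gt0P; exists i0.
have Aoo : (mu A < +oo)%E by rewrite A1 ltry.
have fi i : mu.-integrable A (EFin \o f i).
  apply: (@bounded_integrable _ _ _ _ _ _ B) => // x Ax.
  by have /andP[f0 fb] := fB i x Ax; rewrite ger0_norm.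
have ffi i j : mu.-integrable A (EFin \o (fun x => f i x * f j x)).
  apply: (@bounded_integrable _ _ _ _ _ _ (B * B)) => //.
    exact: measurable_funM.
  move=> x Ax; have /andP[f0 fb] := fB i x Ax; have /andP[g0 gb] := fB j x Ax.
  by rewrite ger0_norm ?mulr_ge0// ler_pM.
have i1 : mu.-integrable A (EFin \o cst (1 : R)).
  by apply: (@bounded_integrable _ _ _ _ _ _ 1) => // x _; rewrite normr1.
have [ci c1] : M.-integrable (box A m) (EFin \o cst (1 : R)) /\
    \int[M]_(x in box A m) 1 = 1.
  have E : (fun x : m.-tuple T => \prod_(a < m) cst (1 : R) (tnth x a)) = cst 1.
    by apply/funext => x; rewrite big1.
  have [] := box_integral mA (fun a : 'I_m => i1); rewrite E => ? ->; split=> //.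
  rewrite big1// => a _; rewrite Rintegral_cst// mul1r.
  exact: (congr1 fine A1).
have Pi i : M.-integrable (box A m) (EFin \o P i).
  by have [] := box_integral mA (fun a : 'I_m => fi i).
have PE i : \int[M]_(x in box A m) P i x = 1.
  by have [_ ->] := box_integral mA (fun a : 'I_m => fi i); rewrite big1.
have PPi i j : M.-integrable (box A m) (EFin \o (fun x => P i x * P j x)) /\
    \int[M]_(x in box A m) (P i x * P j x) =
    (\int[mu]_(x in A) (f i x * f j x)) ^+ m.
  have [+ h2] := box_integral mA (fun a : 'I_m => ffi i j).
  have E : (fun x : m.-tuple T => \prod_(a < m) (f i (tnth x a) * f j (tnth x a))) =
      (fun x => P i x * P j x) by apply/funext => x; rewrite big_split.
  rewrite E in h2 *; split=> //.
  by rewrite h2 prodr_const card_ord.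
have P0 i x : box A m x -> 0 <= P i x.
  by move=> xA; apply: prodr_ge0 => a _; have /andP[] := fB i _ (xA a).
have phii : M.-integrable (box A m) (EFin \o phi).
  apply: le_integrable ci => //.
    by apply/measurable_EFinP; apply: measurable_funTS.
  move=> x _; have /andP[p0 p1] := phi01 x.
  by rewrite /= lee_fin normr1 ger0_norm.
have phiPi i : M.-integrable (box A m) (EFin \o (fun x => (1 - phi x) * P i x)).
  apply: le_integrable (Pi i) => //.
    apply/measurable_EFinP; apply: measurable_funM.
      by apply: measurable_funB => //; exact: measurable_funTS.
    by apply/measurable_EFinP; case/integrableP : (Pi i).
  move=> x _; have /andP[p0 p1] := phi01 x.
  rewrite /= lee_fin normrM ler_piMl// ger0_norm ?subr_ge0//.
  by rewrite lerBlDr lerDl.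
pose v i := \int[M]_(x in box A m) phi x +
  \int[M]_(x in box A m) ((1 - phi x) * P i x).
suff vS : 2^-1 * N <= \sum_i v i.
  suff [i vi] : exists i, 2^-1 <= v i.
    exists i; have Fp := integrable_fin_num mB phii.
    have Fv := integrable_fin_num mB (phiPi i).
    by rewrite -(fineK Fp) -(fineK Fv) -EFinD lee_fin.
  apply/not_existsP => h; move: vS; apply/negP; rewrite -ltNge.
  have -> : 2^-1 * N = \sum_(i : I) 2^-1 by rewrite sumr_const -[RHS]mulr_natr.
  apply: ltr_sum; first by apply/hasP; exists i0 => //; rewrite mem_index_enum.
  by move=> i _; rewrite ltNge; apply/negP; exact: h.
have [SPi SPE] := Rintegral_sum mB phiPi.
have [Si SE] := Rintegral_sum mB Pi.
have PPi' i := Rintegral_sum mB (fun j => (PPi i j).1).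
have [SSi SSE] := Rintegral_sum mB (fun i => (PPi' i).1).
rewrite big_split /= sumr_const -/N -[X in X + _]mulr_natl -/N -SPE.
rewrite -(RintegralZl _ mB phii) -RintegralD//; last exact: integrableZlR.
(* The pointwise bound, multiplied by the number [N] of alternatives; the sum of
   the likelihoods is [N] times their average L. *)
have gi : M.-integrable (box A m) (EFin \o (fun x => - (N / 4) * 1 +
    (2 * (\sum_i P i x) + - N^-1 * (\sum_i \sum_j P i x * P j x)))).
  apply: (integrableDR mB); first exact: (integrableZlR mB).
  by apply: (integrableDR mB); exact: (integrableZlR mB).
apply: le_trans (le_Rintegral mB gi _ _).
- rewrite RintegralD//; [|exact: (integrableZlR mB)|]; last first.
    by apply: (integrableDR mB); exact: (integrableZlR mB).
  rewrite RintegralD//; [|exact: (integrableZlR mB)..].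
  rewrite !RintegralZl// c1 SE SSE.
  rewrite [X in 2 * X](eq_bigr (fun=> 1)); last by move=> i _; exact: PE.
  rewrite sumr_const -/N.
  have -> : \sum_i \int[M]_(x in box A m) (\sum_j P i x * P j x) =
      \sum_i \sum_j (\int[mu]_(x in A) (f i x * f j x)) ^+ m.
    apply: eq_bigr => i _; rewrite (PPi' i).2.
    by apply: eq_bigr => j _; rewrite (PPi i j).2.
  have : N^-1 * (\sum_i \sum_j (\int[mu]_(x in A) (f i x * f j x)) ^+ m) <= 5 / 4 * N.
    by rewrite ler_pdivrMl// (le_trans chi)// expr2 mulrCA.
  by rewrite -/N; lra.
- by apply: (integrableDR mB) => //; exact: (integrableZlR mB).
- move=> x xA; rewrite -mulr_sumr.
  have -> : \sum_i \sum_j P i x * P j x = (\sum_i P i x) ^+ 2.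
    rewrite expr2 mulr_suml; apply: eq_bigr => i _.
    by rewrite mulr_sumr.
  have : 0 <= \sum_i P i x by apply: sumr_ge0 => i _; exact: P0.
  have /andP[] := phi01 x; move: (\sum_i _) (phi x) => S p p0 p1 S0.
  have SN : S = S / N * N by rewrite divfK// gt_eqF.
  rewrite SN; move: (S / N) => L; rewrite exprMn.
  rewrite (_ : - N^-1 * (L ^+ 2 * N ^+ 2) = - (L ^+ 2) * N); last first.
    by field; rewrite gt_eqF.
  have q : 0 <= p * (1 - L) + (L - 2^-1) ^+ 2.
    have [L1|L1] := leP L 1.
      by rewrite addr_ge0 ?sqr_ge0// mulr_ge0// subr_ge0.
    have : 0 <= (1 - p) * (L - 1) by rewrite mulr_ge0// subr_ge0// ltW.
    by have := sqr_ge0 (L - 1); rewrite !expr2; lra.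
  by rewrite -subr_ge0 (_ : _ - _ = (p * (1 - L) + (L - 2^-1) ^+ 2) * N);
    [rewrite mulr_ge0// ltW|field].
Qed.
End mixture.

(** * Multilinear forms and Hoelder classes from partial derivatives *)

Section enorm.
Context (R : realType) (d : nat).
Local Notation E := 'rV[R]_d.

Lemma enorm_ge0 (v : E) : 0 <= enorm v.
Proof. exact: sqrtr_ge0. Qed.

Lemma coord_le_enorm (v : E) i : `|v 0 i| <= enorm v.
Proof.
rewrite -sqrtr_sqr ler_wsqrtr// (bigD1 i)//= lerDl.
by apply: sumr_ge0 => j _; exact: sqr_ge0.
Qed.

Lemma enormZ (t : R) (v : E) : enorm (t *: v) = `|t| * enorm v.
Proof.
rewrite /enorm -sqrtr_sqr -sqrtrM ?sqr_ge0//; congr Num.sqrt.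
by rewrite mulr_sumr; apply: eq_bigr => i _; rewrite mxE exprMn.
Qed.

End enorm.

Section form.
Context (R : realType) (d : nat).
Local Notation E := 'rV[R]_d.
Implicit Types (P Q : seq 'I_d -> R) (v : seq E).

(** The form of coefficients [P], indexed by lists of coordinates. The recursion
consumes the first vector together with the outermost partial derivative, which
is the side on which [is_frechet_derivative] inserts the increment; the
derivatives of all orders then come from the same expression. *)
Fixpoint form P v : R :=
  if v is u :: v' then \sum_i u 0 i * form (fun a => P (i :: a)) v' else P [::].

Lemma formB P Q v : form (fun a => P a - Q a) v = form P v - form Q v.
Proof.
elim: v P Q => //= u v IHv P Q; rewrite -sumrB; apply: eq_bigr => i _.
by rewrite -mulrBr -IHv.
Qed.

Lemma form_sum (I : finType) (c : I -> R) (P : I -> seq 'I_d -> R) v :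
  form (fun a => \sum_k c k * P k a) v = \sum_k c k * form (P k) v.
Proof.
elim: v P => //= u v IHv P.
under eq_bigr do rewrite IHv mulr_sumr.
rewrite exchange_big; apply: eq_bigr => k _; rewrite mulr_sumr.
by apply: eq_bigr => i _; rewrite mulrCA.
Qed.

Lemma form_multilinear k P : multilinear k (form P).
Proof.
move=> u v a x y _; elim: u P => [|w u IHu] P /=.
  rewrite mulr_sumr -big_split; apply: eq_bigr => i _ /=.
  by rewrite !mxE mulrDl mulrA.
rewrite mulr_sumr -big_split; apply: eq_bigr => i _ /=.
by rewrite IHu mulrDr mulrCA.
Qed.

Lemma form_le (C : R) P v :
  (forall a, size a = size v -> `|P a| <= C) ->
  {in v, forall x, enorm x <= 1} -> `|form P v| <= d%:R ^+ size v * C.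
Proof.
elim: v P => [|u v IHv] P /= PC v1; first by rewrite mul1r PC.
apply: (le_trans (ler_norm_sum _ _ _)).
have -> : d%:R ^+ (size v).+1 * C = \sum_(i < d) d%:R ^+ size v * C.
  by rewrite sumr_const card_ord exprS -mulrA [LHS]mulr_natl.
apply: ler_sum => i _; rewrite normrM -[leRHS]mul1r ler_pM//.
  by rewrite (le_trans (coord_le_enorm _ _))// v1// mem_head.
apply: IHv => [a sa|x xv]; first by rewrite PC//= sa.
by rewrite v1// in_cons xv orbT.
Qed.

End form.

Section jet.
Context (R : realType) (d : nat).
Local Notation E := 'rV[R]_d.
Variable P : seq 'I_d -> E -> R.

(** The functions [P (i :: a)] are the partial derivatives of [P a], in the
form in which they are used: along every line. *)
Definition line_derivable (a : seq 'I_d) := forall (x v : E) (t : R),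
  is_derive t (1 : R) (fun t => P a (x + t *: v))
    (\sum_i v 0 i * P (i :: a) (x + t *: v)).

Lemma line_mvt a (x v : E) : line_derivable a ->
  exists2 t : R, 0 <= t <= 1 &
    P a (x + v) - P a x = \sum_i v 0 i * P (i :: a) (x + t *: v).
Proof.
move=> Da; have cf := is_derive_continuous (Da x v).
have [|t t01] := @MVT_segment R _ _ 0 1 ler01 (fun t _ => Da x v t).
  exact: continuous_subspaceT.
rewrite scale1r scale0r addr0 subr0 mulr1 => ->.
by exists t => //; move: t01; rewrite in_itv.
Qed.

Lemma line_lipschitz a C (x v : E) : line_derivable a ->
  (forall i y, `|P (i :: a) y| <= C) ->
  `|P a (x + v) - P a x| <= d%:R * C * enorm v.
Proof.
move=> Da PC; have [t _ ->] := line_mvt x v Da.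
apply: (le_trans (ler_norm_sum _ _ _)).
have -> : d%:R * C * enorm v = \sum_(i < d) C * enorm v.
  by rewrite sumr_const card_ord -mulrA mulr_natl.
apply: ler_sum => i _; rewrite normrM mulrC ler_pM//.
exact: coord_le_enorm.
Qed.

(** Two applications of the mean value theorem: one to [P a] on the segment from
[x] to [x + v], one to each partial derivative up to the point that the first
one provides. *)
Lemma line_taylor a C (x v : E) : line_derivable a ->
  (forall i, line_derivable (i :: a)) ->
  (forall i j y, `|P (i :: j :: a) y| <= C) ->
  `|P a (x + v) - P a x - \sum_i v 0 i * P (i :: a) x| <=
    d%:R ^+ 2 * C * enorm v ^+ 2.
Proof.
move=> Da Dia PC; have [t /andP[t0 t1] ->] := line_mvt x v Da.
rewrite -sumrB; apply: (le_trans (ler_norm_sum _ _ _)).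
have -> : d%:R ^+ 2 * C * enorm v ^+ 2 =
    \sum_(i < d) (enorm v * (d%:R * C * enorm v)).
  rewrite sumr_const card_ord -[RHS]mulr_natl; ring.
apply: ler_sum => i _; rewrite -mulrBr normrM ler_pM//.
  exact: coord_le_enorm.
have C0 : 0 <= C by apply: le_trans (PC i i x).
apply: (le_trans (line_lipschitz x (t *: v) (Dia i) (fun k => PC k i))).
rewrite enormZ ger0_norm// ler_wpM2l ?mulr_ge0//.
by rewrite ler_piMl// enorm_ge0.
Qed.

Lemma near_enorm (x : E) (e : R) : 0 < e -> \forall y \near x, enorm (y - x) <= e.
Proof.
move=> e0; apply/nbhs_ballP; exists (e / d.+1%:R) => /=.
  by rewrite divr_gt0.
move=> y xy; rewrite /enorm -(ger0_norm (ltW e0)) -sqrtr_sqr ler_wsqrtr//.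
apply: (@le_trans _ _ (\sum_(i < d) (e ^+ 2 / d.+1%:R))).
  apply: ler_sum => i _; have := xy.2 0 i; rewrite /ball /= distrC => h.
  rewrite !mxE -real_normK ?num_real//.
  have h2 : `|y 0 i - x 0 i| ^+ 2 <= (e / d.+1%:R) ^+ 2.
    by rewrite lerXn2r ?(ltW h)// nnegrE divr_ge0// ltW.
  apply: (le_trans h2); rewrite expr_div_n ler_wpM2l ?sqr_ge0//.
  by rewrite lef_pV2 ?posrE ?exprn_gt0// expr2 ler_peMl// (ler_nat _ 1).
rewrite sumr_const card_ord -[leLHS]mulr_natr -mulrA ler_piMr ?sqr_ge0//.
by rewrite ler_pdivrMl// mulr1 ler_nat.
Qed.

Lemma opnorm_form k (Q : seq 'I_d -> R) (M : R) : (0 < d)%N ->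
  (forall a, size a = k -> d%:R ^+ k * `|Q a| <= M) ->
  (opnorm k (form Q) <= M%:E)%E.
Proof.
move=> d0 QM; apply: ge_ereal_sup => _ [v [vk v1] <-]; rewrite lee_fin.
have dk : 0 < d%:R ^+ k :> R by rewrite exprn_gt0// ltr0n.
have -> : M = d%:R ^+ size v * (M / d%:R ^+ k).
  by rewrite vk mulrC divfK// gt_eqF.
apply: form_le => // a ak; rewrite ler_pdivlMr// mulrC QM//.
by rewrite ak.
Qed.

(** By linearity of [form], every quantity that the class constrains is the
operator norm of the form of some coefficients, so it suffices to bound these.
The Taylor estimate is quadratic in the increment and thus gives the
differentiability. The bound [C] enters only there, so it may be
arbitrarily large compared to [L]. *)
Lemma holder_of_jet (s L : R) (C : R) : (0 < d)%N ->
  (forall a, (size a <= (sfloor s).+1)%N -> line_derivable a) ->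
  (forall a x, (size a <= (sfloor s).+2)%N -> `|P a x| <= C) ->
  (forall a x, (size a <= sfloor s)%N -> d%:R ^+ size a * `|P a x| <= L) ->
  (forall a x y, size a = sfloor s -> d%:R ^+ sfloor s * `|P a x - P a y| <=
    L * enorm (x - y) `^ (s - (sfloor s)%:R)) ->
  holder s L (P [::]).
Proof.
move=> d0; set p := sfloor s => Dp PC PL PH.
exists (fun _ x => form (P ^~ x)); split.
- split=> // [j x _ _|j x jp _ e e0]; first exact: form_multilinear.
  have C0 : 0 <= C by apply: le_trans (PC [::] x _).
  pose C' := d%:R ^+ j * (d%:R ^+ 2 * C) + 1.
  have C'0 : 0 < C' by rewrite ltr_wpDl// !mulr_ge0// exprn_ge0.
  rewrite near_withinE; have := @near_enorm x (e / C') (divr_gt0 e0 C'0).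
  apply: filterS => y yx _.
  rewrite (_ : (fun v => _) = form (fun a => P a (x + (y - x)) - P a x -
      \sum_i (y - x) 0 i * P (i :: a) x)); last first.
    by apply/funext => v; rewrite 2!formB form_sum (addrC x) subrK.
  apply: opnorm_form => // a aj.
  have h := @line_taylor a C x (y - x) _ _ _.
  apply: (@le_trans _ _ (C' * enorm (y - x) ^+ 2)).
    apply: (@le_trans _ _ (d%:R ^+ j * (d%:R ^+ 2 * C * enorm (y - x) ^+ 2))).
      rewrite ler_wpM2l ?exprn_ge0//; apply: h => [|i|i k z].
      + by apply: Dp; rewrite aj ltnW// ltnS ltnW.
      + by apply: Dp; rewrite /= aj ltnS ltnW.
      + by apply: PC; rewrite /= aj !ltnS ltnW.
    by rewrite mulrA ler_wpM2r ?sqr_ge0// lerDl.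
  rewrite expr2 mulrA ler_wpM2r ?enorm_ge0//.
  by rewrite mulrC -ler_pdivlMr.
- move=> x y _ _; rewrite (_ : (fun v => _) =
    form (fun a => P a x - P a y)); last by apply/funext => v; rewrite formB.
  by apply: opnorm_form => // a ap; exact: PH.
- by move=> j x jp _; apply: opnorm_form => // a aj; rewrite -aj PL// aj.
Qed.

End jet.

(** * Bumps on the cells of a grid *)

Section derive_big.
Context (R : realType).

Lemma is_derive_bigsum (I : finType) (c : I -> R) (f : I -> R -> R) (f' : I -> R)
    (t : R) : (forall k, is_derive t (1 : R) (f k) (f' k)) ->
  is_derive t (1 : R) (fun t => \sum_k c k * f k t) (\sum_k c k * f' k).
Proof.
move=> fd; elim: (index_enum I) => [|k r IHr].
  have -> : (fun t => \sum_(k <- [::]) c k * f k t) = cst 0.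
    by apply/funext => u; rewrite big_nil.
  by rewrite big_nil; exact: is_derive_cst.
have -> : (fun t => \sum_(j <- k :: r) c j * f j t) =
    (c k \*: f k) + (fun t => \sum_(j <- r) c j * f j t).
  by apply/funext => u; rewrite big_cons.
by rewrite big_cons; apply: is_deriveD; exact: is_deriveZ.
Qed.

(** The form of the derivative, with one factor replaced in each product, is the
one that matches [cellbump] when a coordinate is added to the list. *)
Lemma is_derive_bigprod n (f : 'I_n -> R -> R) (f' : 'I_n -> R) (t : R) :
  (forall b, is_derive t (1 : R) (f b) (f' b)) ->
  is_derive t (1 : R) (fun t => \prod_b f b t)
    (\sum_i \prod_b (if b == i then f' b else f b t)).
Proof.
elim: n f f' => [|n IHn] f f' fd.
  have -> : (fun t => \prod_(b < 0) f b t) = cst 1.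
    by apply/funext => u; rewrite big_ord0.
  by rewrite big_ord0; exact: is_derive_cst.
have -> : (fun t => \prod_(b < n.+1) f b t) =
    f ord0 * (fun t => \prod_(b < n) f (lift ord0 b) t).
  by apply/funext => u; rewrite big_ord_recl.
have h := is_deriveM (fd ord0) (IHn _ _ (fun b => fd (lift ord0 b))).
apply: (is_derive_eq h); rewrite big_ord_recl addrC; congr (_ + _).
  by rewrite big_ord_recl eqxx [_ *: _]mulrC.
rewrite /GRing.scale /= mulr_sumr; apply: eq_bigr => i _.
rewrite [RHS]big_ord_recl /=; congr (_ * _).
Qed.

End derive_big.

Section cells.
Context (R : realType) (d n Q : nat).
Local Notation E := 'rV[R]_d.
Local Notation cell := {ffun 'I_d -> 'I_n}.

(** The bump of the cell [k] after differentiation in each of the coordinates of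
the list [a], up to the factor [n] that each differentiation brings. *)
Definition cellbump (a : seq 'I_d) (k : cell) (x : E) : R :=
  \prod_b bump Q (count_mem b a).+1 (n%:R * x 0 b - (k b)%:R).

Lemma cellbump_line_derive a k (x v : E) (t : R) : ((size a).+2 < Q)%N ->
  is_derive t (1 : R) (fun t => cellbump a k (x + t *: v))
    (\sum_i v 0 i * (n%:R * cellbump (i :: a) k (x + t *: v))).
Proof.
move=> aQ; have ca b : ((count_mem b a).+2 < Q)%N.
  by apply: leq_trans aQ; rewrite !ltnS count_size.
pose f (b : 'I_d) (u : R) := bump Q (count_mem b a).+1
  ((n%:R * v 0 b) * u + (n%:R * x 0 b - (k b)%:R)).
have E b u : n%:R * (x + u *: v) 0 b - (k b)%:R =
    (n%:R * v 0 b) * u + (n%:R * x 0 b - (k b)%:R) by rewrite !mxE; ring.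
have fd b : is_derive t (1 : R) (f b) ((n%:R * v 0 b) * bump Q (count_mem b a).+2
    ((n%:R * v 0 b) * t + (n%:R * x 0 b - (k b)%:R))).
  by apply: is_derive_affine; exact: bump_is_derive.
have h := is_derive_bigprod fd.
have -> : (fun t => cellbump a k (x + t *: v)) = (fun t => \prod_b f b t).
  by apply/funext => u; apply: eq_bigr => b _; rewrite E.
apply: (is_derive_eq h); apply: eq_bigr => i _.
rewrite mulrA [v 0 i * _]mulrC.
have -> : n%:R * v 0 i = \prod_b (if b == i then n%:R * v 0 b else 1).
  by rewrite -big_mkcond big_pred1_eq.
rewrite -big_split; apply: eq_bigr => b _ /=; rewrite E [i == b]eq_sym.
by case: eqP => //= _; rewrite mul1r.
Qed.

Lemma bump_disjoint m (t : R) (i j : 'I_n) : (m < Q)%N ->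
  bump Q m (t - i%:R) != 0 -> bump Q m (t - j%:R) != 0 -> i = j.
Proof.
move=> mQ hi hj.
have /andP[i0 i1] : 0 < t - i%:R < 1.
  by apply: contraTT hi => h; rewrite negbK; apply/eqP; exact: bump_eq0.
have /andP[j0 j1] : 0 < t - j%:R < 1.
  by apply: contraTT hj => h; rewrite negbK; apply/eqP; exact: bump_eq0.
have h1 : i%:R < j.+1%:R :> R by rewrite -natr1; lra.
have h2 : j%:R < i.+1%:R :> R by rewrite -natr1; lra.
rewrite !ltr_nat !ltnS in h1 h2.
by apply/val_inj/eqP; rewrite eqn_leq h1 h2.
Qed.

Lemma sum_bump_le (B : R) m t : 0 <= B -> (m < Q)%N ->
  (forall u : R, `|bump Q m u| <= B) ->
  \sum_(j < n) `|bump Q m (t - j%:R)| <= B.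
Proof.
move=> B0 mQ BB.
have [[j hj]|h] := pselect (exists j : 'I_n, bump Q m (t - j%:R) != 0).
  rewrite (bigD1 j)//= big1 ?addr0// => i ij; apply/eqP; rewrite normr_eq0.
  by apply: contraR ij => hi; apply/eqP; exact: bump_disjoint hi hj.
rewrite big1// => j _; apply/eqP; rewrite normr_eq0; apply/negPn/negP => hj.
by apply: h; exists j.
Qed.

Lemma cellbump_orthogonal (k l : cell) x : (1 < Q)%N -> k != l ->
  cellbump [::] k x * cellbump [::] l x = 0.
Proof.
move=> Q1 kl; apply/eqP; apply: contraR kl; rewrite mulf_eq0 negb_or.
move=> /andP[/prodf_neq0 hk /prodf_neq0 hl]; apply/eqP/ffunP => b.
exact: bump_disjoint (hk b isT) (hl b isT).
Qed.

(** The bound does not depend on the number of cells. Summing over the cells of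
a product over the coordinates gives the product of one-dimensional sums, and in
each of these at most one term is nonzero. *)
Lemma sum_cellbump_le (B : R) (eta : cell -> R) a x : ((size a).+1 < Q)%N ->
  0 <= B -> (forall m (u : R), (m <= Q)%N -> `|bump Q m u| <= B) ->
  (forall k, `|eta k| <= 1) ->
  `|\sum_k eta k * cellbump a k x| <= B ^+ d.
Proof.
move=> aQ B0 BB eta1; apply: (le_trans (ler_norm_sum _ _ _)).
have ca b : ((count_mem b a).+1 < Q)%N.
  by apply: leq_trans aQ; rewrite !ltnS count_size.
apply: (@le_trans _ _ (\sum_(k : cell) \prod_b
    `|bump Q (count_mem b a).+1 (n%:R * x 0 b - (k b)%:R)|)).
  apply: ler_sum => k _; rewrite normrM normr_prod.
  by rewrite ler_piMl ?prodr_ge0.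
(* A cell is a choice of an interval for each coordinate. *)
rewrite -(bigA_distr_bigA (fun b (j : 'I_n) =>
  `|bump Q (count_mem b a).+1 (n%:R * x 0 b - j%:R)|)).
rewrite -[d in leRHS]card_ord -prodr_const; apply: ler_prod => b _.
rewrite sumr_ge0//= sum_bump_le// => u; rewrite BB//.
exact: ltnW.
Qed.

End cells.

(** * Smoothness of the alternatives *)

Lemma sfloor_bounds (R : realType) (s : R) : 0 < s ->
  (sfloor s)%:R < s <= (sfloor s)%:R + 1.
Proof.
move=> s0; have c0 : (0 < Num.ceil s)%R by rewrite ceil_gt0.
have -> : (sfloor s)%:R = (Num.ceil s)%:~R - 1 :> R.
  rewrite /sfloor -[LHS]/((`|Num.ceil s - 1|%N : int)%:~R).
  by rewrite gez0_abs ?intrB// subr_ge0.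
by rewrite subrK ceil_ge andbT ltrBlDr; case/andP: (ceil_itv s); lra.
Qed.

Section alternative_jet.
Context (R : realType) (d n Q : nat).
Local Notation E := 'rV[R]_d.
Local Notation cell := {ffun 'I_d -> 'I_n}.
Variables (gam : R) (eta : cell -> R).

(** The alternative of amplitude [gam] and signs [eta] (for the empty list) and
its partial derivatives; only the value itself sees the constant 1. *)
Definition alt_jet (a : seq 'I_d) (x : E) : R :=
  (a == [::])%:R +
  gam * n%:R ^+ size a * \sum_k eta k * cellbump Q a k x.

Lemma alt_jet_line_derivable a : ((size a).+2 < Q)%N -> line_derivable alt_jet a.
Proof.
move=> aQ x v t.
have h := is_derive_bigsum eta (fun k => cellbump_line_derive k x v t aQ).
have h2 := is_deriveD (is_derive_cst ((a == [::])%:R : R) t (1 : R))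
  (is_deriveZ (gam * n%:R ^+ size a) h).
apply: (is_derive_eq h2); rewrite add0r /GRing.scale /=.
under eq_bigr do rewrite mulr_sumr.
rewrite exchange_big mulr_sumr; apply: eq_bigr => i _ /=.
rewrite /alt_jet /= add0r !mulr_sumr; apply: eq_bigr => k _; rewrite exprS; ring.
Qed.

Lemma alt_jet_le (B : R) a x : 0 <= gam -> ((size a).+1 < Q)%N -> 0 <= B ->
  (forall m (u : R), (m <= Q)%N -> `|bump Q m u| <= B) ->
  (forall k, `|eta k| <= 1) ->
  `|alt_jet a x - (a == [::])%:R| <= gam * n%:R ^+ size a * B ^+ d.
Proof.
move=> g0 aQ B0 BB eta1; rewrite /alt_jet addrAC subrr add0r normrM.
have c0 : 0 <= gam * n%:R ^+ size a by rewrite mulr_ge0 ?exprn_ge0.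
by rewrite ger0_norm// ler_wpM2l// sum_cellbump_le.
Qed.

End alternative_jet.

(** All derivatives of order [j] are bounded by gam n^j B^d, and gam n^j is at
most [c1] for j <= s. For the Hoelder condition on the derivatives of order
p = [sfloor s], with w = n |x - y|, the increment is at most
gam n^p B^d min(2, d w), from the sup norm and from the derivative of order
p + 1; since 0 < s - p <= 1, this minimum is at most 2 d w^(s-p). The order
[p + 4] of the bump leaves room for derivatives of order p + 2. *)
Lemma alt_jet_holder (R : realType) (d n : nat) (s L B c1 : R)
    (eta : {ffun 'I_d -> 'I_n} -> R) :
  (0 < d)%N -> (0 < n)%N -> 0 < s -> 1 < L -> 1 <= B -> 0 < c1 ->
  (forall m (u : R), (m <= (sfloor s).+4)%N -> `|bump (sfloor s).+4 m u| <= B) ->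
  (forall k, `|eta k| <= 1) ->
  2 * d%:R ^+ (sfloor s).+1 * c1 * B ^+ d <= 1 -> c1 * B ^+ d <= L - 1 ->
  holder s L (alt_jet (sfloor s).+4 (c1 * n%:R `^ (- s)) eta [::]).
Proof.
move=> d0 n0 s0 L1 B1 c10 BB eta1 hc1 hc2.
set p := sfloor s in BB hc1 *; set gam := c1 * _; set P := alt_jet _ _ _.
have /andP[ps sp] := sfloor_bounds s0; rewrite -/p in ps sp.
have B0 : 0 <= B by lra.
have n1 : 1 <= n%:R :> R by rewrite (ler_nat _ 1).
have n0' : 0 < n%:R :> R by lra.
have d1 : 1 <= d%:R :> R by rewrite (ler_nat _ 1).
have BD : 0 <= B ^+ d by rewrite exprn_ge0.
have g0 : 0 <= gam by rewrite mulr_ge0 ?powR_ge0// ltW.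
have gn j : gam * n%:R ^+ j = c1 * n%:R `^ (j%:R - s).
  rewrite /gam -mulrA -powR_mulrn ?ler0n// -powRD ?(addrC (- s))//.
  by rewrite (gt_eqF n0') implybT.
have gn1 j : (j <= p)%N -> gam * n%:R ^+ j <= c1.
  move=> jp; rewrite gn ler_piMr ?(ltW c10)//.
  rewrite -[leRHS](powRr0 n%:R) ler_powR// subr_le0 (le_trans _ (ltW ps))//.
  by rewrite ler_nat.
have Pb a x : (size a <= p.+2)%N ->
    `|P a x - (a == [::])%:R| <= gam * n%:R ^+ size a * B ^+ d.
  by move=> ap; apply: alt_jet_le => //; rewrite !ltnS.
have dp j : (j <= p)%N -> d%:R ^+ j * (c1 * B ^+ d) <= 1.
  move=> jp; apply: le_trans hc1.
  have dj : d%:R ^+ j <= d%:R ^+ p.+1 :> R by rewrite ler_weXn2l// (leq_trans jp).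
  have dj0 : 0 <= d%:R ^+ j :> R by rewrite exprn_ge0.
  have cb : 0 <= c1 * B ^+ d by rewrite mulr_ge0// ltW.
  by rewrite -mulrA ler_wpM2r//; lra.
apply: (@holder_of_jet R d P s L (1 + gam * n%:R ^+ p.+2 * B ^+ d)) => //.
- by move=> a ap; apply: alt_jet_line_derivable; rewrite !ltnS.
- move=> a x ap; rewrite -[P a x](subrK (a == [::])%:R) addrC.
  apply: (le_trans (ler_normD _ _)); apply: lerD.
    by case: eqP; rewrite ?normr1 ?normr0.
  apply: (le_trans (Pb a x ap)); rewrite ler_wpM2r// ler_wpM2l//.
  by rewrite ler_weXn2l.
- move=> a x ap.
  have h : `|P a x - (a == [::])%:R| <= c1 * B ^+ d.
    apply: (le_trans (Pb a x _)); first by rewrite (leq_trans ap)// ltnW.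
    by rewrite ler_wpM2r// gn1.
  case: a ap h => [|i a] ap h.
    rewrite expr0 mul1r -[P _ x](subrK 1) (le_trans (ler_normD _ _))//.
    by rewrite normr1 -lerBrDr (le_trans h).
  rewrite subr0 in h; apply: (@le_trans _ _ 1); last exact: ltW.
  by apply: le_trans (dp _ ap); rewrite ler_wpM2l// exprn_ge0.
- move=> a x y; rewrite -/p => ap.
  set r := enorm (x - y).
  have r0 : 0 <= r by exact: enorm_ge0.
  have e0 : 0 < s - p%:R by lra.
  have e1 : s - p%:R <= 1 by lra.
  have l1 : `|P a x - P a y| <= 2 * (gam * n%:R ^+ p * B ^+ d).
    rewrite (_ : P a x - P a y = (P a x - (a == [::])%:R) -
      (P a y - (a == [::])%:R)); last by ring.
    apply: (le_trans (ler_normB _ _)); rewrite mulr_natl mulr2n -ap.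
    by apply: lerD; apply: Pb; rewrite ap ltnW.
  have l2 : `|P a x - P a y| <= d%:R * (gam * n%:R ^+ p * B ^+ d) * (n%:R * r).
    have -> : d%:R * (gam * n%:R ^+ p * B ^+ d) * (n%:R * r) =
        d%:R * (gam * n%:R ^+ p.+1 * B ^+ d) * r by rewrite exprS; ring.
    rewrite -{1}(subrKC y x); apply: line_lipschitz.
      by apply: alt_jet_line_derivable; rewrite ap.
    move=> i z; have := Pb (i :: a) z; rewrite subr0 /= ap; apply.
    by rewrite ltnS.
  have key : `|P a x - P a y| <=
      2 * d%:R * (gam * n%:R ^+ p * B ^+ d) * (n%:R * r) `^ (s - p%:R).
    have C0 : 0 <= gam * n%:R ^+ p * B ^+ d by rewrite mulr_ge0// mulr_ge0// exprn_ge0.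
    have nr0 : 0 <= n%:R * r by rewrite mulr_ge0.
    (* The sup bound is used for w > 1 and the Lipschitz bound for w <= 1. *)
    move: l1 l2 nr0 C0; set D := gam * _ * _; set w := n%:R * r.
    move=> l1 l2 w0 C0; have dD : D <= d%:R * D by rewrite ler_peMl.
    have [w1|w1] := leP w 1.
      have ww : w <= w `^ (s - p%:R).
        move: w0; rewrite le_eqVlt => /predU1P[<-|w0]; first exact: powR_ge0.
        by rewrite -[leLHS]powRr1 ?(ltW w0)// ger_powR// w0.
      apply: (le_trans l2); apply: ler_pM => //; first by rewrite mulr_ge0.
      by rewrite -mulrA; lra.
    have ww : 1 <= w `^ (s - p%:R).
      by rewrite -[leLHS](powRr0 w) ler_powR ?ltW.
    apply: (le_trans l1); rewrite -[leLHS]mulr1 ler_pM//; lra.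
  apply: (@le_trans _ _ (d%:R ^+ p * (2 * d%:R *
      (gam * n%:R ^+ p * B ^+ d) * (n%:R * r) `^ (s - p%:R)))).
    by rewrite ler_wpM2l// exprn_ge0.
  rewrite powRM// gn.
  have -> : d%:R ^+ p * (2 * d%:R * (c1 * n%:R `^ (p%:R - s) * B ^+ d) *
     (n%:R `^ (s - p%:R) * r `^ (s - p%:R))) =
     (2 * d%:R ^+ p.+1 * c1 * B ^+ d) *
     (n%:R `^ (p%:R - s) * n%:R `^ (s - p%:R)) * r `^ (s - p%:R).
    by rewrite exprS; ring.
  rewrite -powRD ?(gt_eqF n0') ?implybT// addrA subrK subrr powRr0 mulr1.
  by rewrite ler_wpM2r ?powR_ge0// (le_trans hc1) ?ltW.
Qed.

(** * Averages over random signs *)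

Section rademacher.
Context (R : realType).

Lemma expR_le_inv (y : R) : y < 1 -> expR y <= (1 - y)^-1.
Proof.
move=> y1; rewrite -[y in expR y]opprK expRN lef_pV2 ?posrE ?expR_gt0 ?subr_gt0//.
exact: expR_ge1Dx.
Qed.

Lemma expR_le_quad (y : R) : `|y| <= 2^-1 -> expR y <= 1 + y + 2 * y ^+ 2.
Proof.
rewrite ler_norml => /andP[y0 y1].
apply: (le_trans (expR_le_inv _)); first lra.
rewrite -[leLHS]mul1r ler_pdivrMr; last lra.
have : 0 <= y ^+ 2 * (1 - 2 * y) by rewrite mulr_ge0 ?sqr_ge0//; lra.
by rewrite !expr2; lra.
Qed.

(** A crude form, for small [y], of cosh y <= exp(y^2 / 2). *)
Lemma expR_sym_le (x y : R) : `|y| <= x -> x <= 2^-1 ->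
  expR y + expR (- y) <= 2 * expR (2 * x ^+ 2).
Proof.
move=> yx x1; have h1 := expR_le_quad (le_trans yx x1).
have h2 : expR (- y) <= 1 + - y + 2 * (- y) ^+ 2.
  by apply: expR_le_quad; rewrite normrN (le_trans yx).
have h3 : y ^+ 2 <= x ^+ 2.
  by rewrite -(real_normK (num_real y)) lerXn2r// nnegrE (le_trans _ yx).
have := expR_ge1Dx (2 * x ^+ 2); rewrite sqrrN in h2; lra.
Qed.

Definition rsign (b : bool) : R := (-1) ^+ b.

Lemma normr_rsign b : `|rsign b| = 1.
Proof. by rewrite /rsign normr_sign. Qed.

Variables (K : finType) (rho : K -> R) (x : R).
Hypotheses (rho0 : forall k, 0 <= rho k <= x) (x_le : x <= 2^-1).

(** For fixed signs [e], the average over [e'] factors over the cells into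
hyperbolic cosines. *)
Lemma rademacher_laplace (e : {ffun K -> bool}) :
  \sum_(e' : {ffun K -> bool}) expR (\sum_k rsign (e k) * rsign (e' k) * rho k) <=
  #|{ffun K -> bool}|%:R * expR (#|K|%:R * (2 * x ^+ 2)).
Proof.
under eq_bigr do rewrite expR_sum.
rewrite -(bigA_distr_bigA (fun k b => expR (rsign (e k) * rsign b * rho k))).
rewrite card_ffun card_bool expRM_natl natrX -exprMn -prodr_const.
apply: ler_prod => k _; rewrite big_bool addr_ge0 ?expR_ge0//=.
rewrite /rsign expr1 expr0 mulrN1 mulr1 mulNr addrC expR_sym_le//.
have /andP[r0 rx] := rho0 k.
by rewrite normrM -/(rsign _) normr_rsign mul1r ger0_norm.
Qed.

(** The left-hand side is, up to normalization, the second moment over [m]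
samples of the likelihood ratio of the mixture over all signs, [tau k] being
the squared norm of the perturbation on the cell [k]. *)
Lemma rademacher_second_moment (m : nat) (tau : K -> R) :
  (forall k, rho k = m%:R * tau k) ->
  (forall e e' : {ffun K -> bool},
    0 <= 1 + \sum_k rsign (e k) * rsign (e' k) * tau k) ->
  #|K|%:R * (2 * x ^+ 2) <= 5^-1 ->
  \sum_(e : {ffun K -> bool}) \sum_(e' : {ffun K -> bool})
    (1 + \sum_k rsign (e k) * rsign (e' k) * tau k) ^+ m <=
  5 / 4 * #|{ffun K -> bool}|%:R ^+ 2.
Proof.
move=> rhoE pos Kx; set N := #|{ffun K -> bool}|%:R.
have -> : 5 / 4 * N ^+ 2 = \sum_(e : {ffun K -> bool}) (N * (5 / 4)).
  by rewrite sumr_const -[RHS]mulr_natl -/N expr2; ring.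
apply: ler_sum => e _.
apply: (@le_trans _ _ (\sum_(e' : {ffun K -> bool})
    expR (\sum_k rsign (e k) * rsign (e' k) * rho k))).
  apply: ler_sum => e' _.
  have -> : \sum_k rsign (e k) * rsign (e' k) * rho k =
      m%:R * \sum_k rsign (e k) * rsign (e' k) * tau k.
    by rewrite mulr_sumr; apply: eq_bigr => k _; rewrite rhoE mulrCA.
  by rewrite expRM_natl lerXn2r// ?nnegrE ?expR_ge0// expR_ge1Dx.
apply: (le_trans (rademacher_laplace e)); rewrite ler_wpM2l//.
apply: (le_trans (expR_le_inv _)); first lra.
rewrite -[leLHS]mul1r ler_pdivrMr; lra.
Qed.

End rademacher.

(** * Moments of the alternatives *)

Section cube.
Context (R : realType) (d : nat).
Local Notation pt := (d.-tuple (measurableTypeR R)).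
Local Notation leb := (@lebesgue_measure R).

Lemma ptcubeE : @ptcube R d = box (`[0, 1]%classic : set (measurableTypeR R)) d.
Proof.
apply/seteqP; split => x /= h i; have := h i; rewrite mxE /= ?in_itv//.
Qed.

Lemma cube_integral (g : 'I_d -> R -> R) : (forall b, continuous (g b)) ->
  (nu R d).-integrable (@ptcube R d)
    (EFin \o (fun x => \prod_(b < d) g b (tnth x b))) /\
  \int[nu R d]_(x in @ptcube R d) (\prod_(b < d) g b (tnth x b)) =
  \prod_(b < d) \int[leb]_(t in `[0, 1]) g b t.
Proof.
move=> gc; rewrite ptcubeE; apply: box_integral => // b.
exact: continuous_itv_integrable.
Qed.

Lemma measurable_ptcube : measurable (@ptcube R d).
Proof. by rewrite ptcubeE; exact: measurable_box. Qed.

Lemma cube_integrable1 :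
  (nu R d).-integrable (@ptcube R d) (EFin \o cst (1 : R)).
Proof.
have c1 (b : 'I_d) : continuous (cst (1 : R) : R -> R).
  by move=> ?; exact: cst_continuous.
have [+ _] := cube_integral c1.
by congr (_.-integrable _ (EFin \o _)); apply/funext => x; rewrite big1.
Qed.

Lemma nu_ptcube : nu R d (@ptcube R d) = 1%E.
Proof.
have fnu : nu R d (@ptcube R d) \is a fin_num.
  have := integrable_fin_num measurable_ptcube cube_integrable1.
  by rewrite (@integral_cst _ _ _ (nu R d) _ measurable_ptcube 1%:E) mul1e.
rewrite -(fineK fnu); congr _%:E.
have c1 (b : 'I_d) : continuous (cst (1 : R) : R -> R).
  by move=> ?; exact: cst_continuous.
have [_] := cube_integral c1.
rewrite [RHS]big1 => [|b _]; last first.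
  by rewrite Rintegral_cst//= lebesgue_measure_itv /= lte_fin ltr01 mul1r oppr0 addr0.
move=> <-; rewrite -[LHS]mul1r -Rintegral_cst; last exact: measurable_ptcube.
by apply: eq_Rintegral => x _; rewrite big1.
Qed.

End cube.

Section moments.
Context (R : realType) (d n Q : nat) (d0 : (0 < d)%N) (Q2 : (2 < Q)%N).
Local Notation pt := (d.-tuple (measurableTypeR R)).
Local Notation cell := {ffun 'I_d -> 'I_n}.
Local Notation C := (@ptcube R d).

Definition cellfun (k : cell) (x : pt) : R := cellbump Q [::] k (vec x).

Lemma cellfunE k x :
  cellfun k x = \prod_b bump Q 1 (n%:R * tnth x b - (k b)%:R).
Proof. by apply: eq_bigr => b _; rewrite mxE. Qed.

Definition cellint (k : cell) : R := \int[nu R d]_(x in C) (cellfun k x ^+ 2).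

Lemma cellfun_int k : (nu R d).-integrable C (EFin \o cellfun k) /\
  \int[nu R d]_(x in C) cellfun k x = 0.
Proof.
have gc b : continuous (fun t : R => bump Q 1 (n%:R * t - (k b)%:R)).
  exact: bump_affine_continuous.
have := cube_integral gc.
have -> : (fun x : pt => \prod_(b < d) bump Q 1 (n%:R * tnth x b - (k b)%:R)) =
  cellfun k by apply/funext => x; rewrite cellfunE.
move=> [fi ->]; split=> //.
by rewrite (bigD1 (Ordinal d0))//= bump_cell_int0// mul0r.
Qed.

Lemma cellfun_sqr_int k :
  (nu R d).-integrable C (EFin \o (fun x => cellfun k x ^+ 2)) /\
  cellint k = \prod_(b < d) \int[@lebesgue_measure R]_(t in `[0, 1])
    bump Q 1 (n%:R * t - (k b)%:R) ^+ 2.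
Proof.
have gc b : continuous (fun t : R => bump Q 1 (n%:R * t - (k b)%:R) ^+ 2).
  exact: bump_cell_sqr_continuous.
have := cube_integral gc.
have -> : (fun x : pt => \prod_(b < d) bump Q 1 (n%:R * tnth x b - (k b)%:R) ^+ 2) =
    (fun x => cellfun k x ^+ 2).
  by apply/funext => x; rewrite cellfunE prodrXl.
by [].
Qed.

Lemma cellint_le (B : R) k : (forall t : R, `|bump Q 1 t| <= B) ->
  cellint k <= (B ^+ 2 / n%:R) ^+ d.
Proof.
move=> BB; rewrite (cellfun_sqr_int k).2 -[in leRHS](card_ord d) -prodr_const.
apply: ler_prod => b _; rewrite Rintegral_ge0/=; last by move=> t _; exact: sqr_ge0.
exact: bump_cell_int2_le.
Qed.

Lemma cellint_ge k : (16^-1 ^+ Q ^+ 2 / 8 / n%:R) ^+ d <= cellint k.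
Proof.
rewrite (cellfun_sqr_int k).2 -[in leLHS](card_ord d) -prodr_const.
apply: ler_prod => b _; rewrite bump_cell_int2_ge// andbT.
by rewrite !divr_ge0// sqr_ge0.
Qed.

(** Every integral of alternatives needed here has this shape, because products of
bumps of different cells vanish. *)
Lemma quadratic_integral (c : R) (a b : cell -> R) :
  let q x := c * 1 +
    (\sum_k a k * cellfun k x + \sum_k b k * cellfun k x ^+ 2) in
  (nu R d).-integrable C (EFin \o q) /\
  \int[nu R d]_(x in C) q x = c + \sum_k b k * cellint k.
Proof.
have mC := @measurable_ptcube R d.
have ia k := integrableZlR mC (a k) (cellfun_int k).1.
have ib k := integrableZlR mC (b k) (cellfun_sqr_int k).1.
have [Sa Ea] := Rintegral_sum mC ia.
have [Sb Eb] := Rintegral_sum mC ib.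
have ic := integrableZlR mC c (cube_integrable1 R d).
move=> q; split; first by apply: integrableDR => //; exact: integrableDR.
rewrite RintegralD//; last exact: integrableDR.
rewrite RintegralD// Ea Eb [X in _ + (X + _)]big1 => [|k _]; last first.
  by rewrite RintegralZl ?(cellfun_int k).2 ?mulr0//; exact: (cellfun_int k).1.
rewrite add0r; congr (_ + _).
  rewrite Rintegral_cst// mulr1 -[RHS]mulr1; congr (_ * _).
  exact: (congr1 fine (nu_ptcube R d)).
by apply: eq_bigr => k _; rewrite RintegralZl//; exact: (cellfun_sqr_int k).1.
Qed.

Lemma cellfun_sum_mul (u w : cell -> R) x :
  (\sum_k u k * cellfun k x) * (\sum_k w k * cellfun k x) =
  \sum_k u k * w k * cellfun k x ^+ 2.
Proof.
rewrite mulr_suml; apply: eq_bigr => k _.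
rewrite mulr_sumr (bigD1 k)//= big1 ?addr0; first by ring.
move=> l lk; rewrite mulrACA [X in _ * X]cellbump_orthogonal ?mulr0 1?eq_sym//.
exact: ltnW.
Qed.

Variable gam : R.
Definition alt (u : cell -> R) : 'rV[R]_d -> R := alt_jet Q gam u [::].

Lemma altE u x : alt u (vec x) = 1 + gam * \sum_k u k * cellfun k x.
Proof. by rewrite /alt /alt_jet eqxx expr0 mulr1. Qed.

Lemma alt_int u :
  (nu R d).-integrable C (EFin \o (fun x => alt u (vec x))) /\
  \int[nu R d]_(x in C) alt u (vec x) = 1.
Proof.
have [] := quadratic_integral 1 (fun k => gam * u k) (fun=> 0).
have -> : (fun x => 1 * 1 + (\sum_k gam * u k * cellfun k x +
    \sum_k 0 * cellfun k x ^+ 2)) = (fun x => alt u (vec x)).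
  apply/funext => x; rewrite altE mulr1 mulr_sumr; congr (_ + _).
  rewrite [X in _ + X]big1 => [|k _]; last by rewrite mul0r.
  by rewrite addr0; apply: eq_bigr => k _; rewrite mulrA.
move=> ? ->; split=> //.
by rewrite big1 ?addr0// => k _; rewrite mul0r.
Qed.

Lemma alt_mul_int u w : \int[nu R d]_(x in C) (alt u (vec x) * alt w (vec x)) =
  1 + \sum_k u k * w k * (gam ^+ 2 * cellint k).
Proof.
have [_ E] := quadratic_integral 1 (fun k => gam * (u k + w k))
  (fun k => gam ^+ 2 * (u k * w k)).
have -> : \sum_k u k * w k * (gam ^+ 2 * cellint k) =
    \sum_k gam ^+ 2 * (u k * w k) * cellint k.
  by apply: eq_bigr => k _; ring.
rewrite -E; apply: eq_Rintegral => x _; rewrite !altE.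
have -> : \sum_k gam * (u k + w k) * cellfun k x =
    gam * (\sum_k u k * cellfun k x) + gam * (\sum_k w k * cellfun k x).
  by rewrite !mulr_sumr -big_split; apply: eq_bigr => k _ /=; ring.
have -> : \sum_k gam ^+ 2 * (u k * w k) * cellfun k x ^+ 2 =
    gam ^+ 2 * ((\sum_k u k * cellfun k x) * (\sum_k w k * cellfun k x)).
  by rewrite cellfun_sum_mul mulr_sumr; apply: eq_bigr => k _ /=; ring.
by ring.
Qed.

Lemma alt_sqr_int u :
  (nu R d).-integrable C (EFin \o (fun x => (alt u (vec x) - f0 (vec x)) ^+ 2)) /\
  \int[nu R d]_(x in C) ((alt u (vec x) - f0 (vec x)) ^+ 2) =
  \sum_k u k ^+ 2 * (gam ^+ 2 * cellint k).
Proof.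
have [] := quadratic_integral 0 (fun=> 0) (fun k => gam ^+ 2 * (u k * u k)).
have -> : (fun x => 0 * 1 + (\sum_k 0 * cellfun k x +
    \sum_k gam ^+ 2 * (u k * u k) * cellfun k x ^+ 2)) =
    (fun x => (alt u (vec x) - f0 (vec x)) ^+ 2).
  apply/funext => x; rewrite altE /f0 /= addrAC subrr mul0r !add0r.
  rewrite [X in X + _]big1 => [|k _]; last by rewrite mul0r.
  rewrite add0r exprMn [(\sum_k _) ^+ 2]expr2 cellfun_sum_mul mulr_sumr.
  by apply: eq_bigr => k _; rewrite -!mulrA.
move=> i ->; split=> //; rewrite add0r; apply: eq_bigr => k _; ring.
Qed.

End moments.

(** * Calibration and conclusion *)

Lemma grid_size (R : realType) (w : R) : 1 <= w ->
  exists2 n : nat, (0 < n)%N & w <= n%:R <= 2 * w.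
Proof.
move=> w1; exists (Num.truncn w).+1 => //.
have w0 : 0 <= w by lra.
have /andP[h1 h2] := truncn_itv w0.
by rewrite ltW//= -natr1; lra.
Qed.

(** [n] is m^(2/(4s+d)) rounded up, and rounding up at most doubles it. The first
inequality says that m^2 n^(-4s-d) <= 1, which bounds the chi-square divergence;
the second one compares n^-s to the rate. *)
Lemma grid_calibration (R : realType) (d m : nat) (s : R) : (0 < d)%N -> 0 < s ->
  (0 < m)%N -> exists2 n : nat, (0 < n)%N &
    m%:R <= n%:R `^ (2 * s) * n%:R `^ (d%:R / 2) :> R /\
    m%:R `^ (- (2 * s / (4 * s + d%:R))) <= 2 `^ s * n%:R `^ (- s) :> R.
Proof.
move=> d0 s0 m0; pose w : R := m%:R `^ (2 / (4 * s + d%:R)).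
have d1 : 1 <= d%:R :> R by rewrite (ler_nat _ 1).
have sd : 0 < 4 * s + d%:R by lra.
have m1 : 1 <= m%:R :> R by rewrite (ler_nat _ 1).
have w1 : 1 <= w.
  by rewrite -[leLHS](powRr0 m%:R) ler_powR// divr_ge0 ?ltW.
have [n n0 /andP[wn nw]] := grid_size w1.
have n1 : 1 <= n%:R :> R by rewrite (ler_nat _ 1).
exists n => //; split.
  rewrite -powRD ?(gt_eqF (lt_le_trans ltr01 n1)) ?implybT//.
  have -> : m%:R = w `^ (2 * s + d%:R / 2) :> R.
    rewrite -powRrM (_ : _ * _ = 1) ?powRr1//.
    by field; rewrite gt_eqF.
  apply: ge0_ler_powR => //; rewrite ?nnegrE; lra.
have -> : m%:R `^ (- (2 * s / (4 * s + d%:R))) = w `^ (- s) :> R.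
  by rewrite -powRrM; congr (_ `^ _); field; rewrite gt_eqF.
rewrite !powRN -[leLHS]mul1r ler_pdivrMr ?powR_gt0//; last lra.
rewrite mulrAC ler_pdivlMr ?powR_gt0//; last lra.
rewrite mul1r -powRM//; last lra.
apply: ge0_ler_powR; rewrite ?nnegrE; lra.
Qed.

Section alternatives.
Context (R : realType) (d n : nat) (s L B c1 : R).
Hypotheses (d0 : (0 < d)%N) (n0 : (0 < n)%N) (s0 : 0 < s) (L1 : 1 < L).
Hypotheses (B1 : 1 <= B) (c10 : 0 < c1).
Local Notation Q := (sfloor s).+4.
Hypothesis BB : forall m (u : R), (m <= Q)%N -> `|bump Q m u| <= B.
Hypotheses (hc1 : 2 * d%:R ^+ (sfloor s).+1 * c1 * B ^+ d <= 1)
  (hc2 : c1 * B ^+ d <= L - 1).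
Local Notation cell := {ffun 'I_d -> 'I_n}.
Local Notation gam := (c1 * n%:R `^ (- s)).

Let B0 : 0 <= B.
Proof. exact: le_trans B1. Qed.

Let c1B0 : 0 <= c1 * B ^+ d.
Proof. by rewrite mulr_ge0 ?(ltW c10) ?exprn_ge0. Qed.

Let c1B : c1 * B ^+ d <= 2^-1.
Proof.
have d1 : 1 <= d%:R ^+ (sfloor s).+1 :> R by rewrite exprn_ege1// (ler_nat _ 1).
have : 1 * (c1 * B ^+ d) <= d%:R ^+ (sfloor s).+1 * (c1 * B ^+ d).
  by rewrite ler_wpM2r.
by move: hc1; rewrite -!mulrA; lra.
Qed.

Let gam_ge0 : 0 <= gam.
Proof. by rewrite mulr_ge0 ?powR_ge0// ltW. Qed.

Let gam_le : gam <= c1.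
Proof.
rewrite ler_piMr ?(ltW c10)// -[leRHS](powRr0 n%:R) ler_powR ?(ler_nat _ 1)//.
by rewrite oppr_le0 ltW.
Qed.

Section one_alternative.
Variable u : cell -> R.
Hypothesis u1 : forall k, `|u k| = 1.

Lemma alt_bounds x : 0 <= alt Q gam u x <= 2.
Proof.
have h : `|alt_jet Q gam u [::] x - 1| <= gam * n%:R ^+ 0 * B ^+ d.
  by apply: alt_jet_le => // k; rewrite u1.
have : `|alt Q gam u x - 1| <= 2^-1.
  apply: (le_trans h); rewrite expr0 mulr1; apply: le_trans c1B.
  by rewrite ler_wpM2r// exprn_ge0.
by rewrite ler_norml => /andP[h1 h2]; apply/andP; split; lra.
Qed.

Lemma alt_measurable :
  measurable_fun (@ptcube R d) (fun x => alt Q gam u (vec x)).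
Proof.
apply/measurable_EFinP.
by have [/integrableP[]] := @alt_int R d n Q d0 isT gam u.
Qed.

Lemma alt_density : is_density (alt Q gam u).
Proof.
split; first exact: alt_measurable.
- by move=> x _; have /andP[] := alt_bounds x.
- have [i1 v1] := @alt_int R d n Q d0 isT gam u.
  have := integrable_fin_num (@measurable_ptcube R d) i1.
  by move=> /fineK <-; congr _%:E.
Qed.

Lemma alt_holder : holder s L (alt Q gam u).
Proof. by apply: (@alt_jet_holder _ _ _ _ _ B) => // k; rewrite u1. Qed.

(** The squared distance is the sum over the n^d cells of squared norms, each of
order gam^2 n^-d. *)
Lemma alt_separated : ((c1 * n%:R `^ (- s) *
   Num.sqrt ((16^-1 ^+ Q ^+ 2 / 8) ^+ d))%:E <= L2dist (alt Q gam u) (@f0 R d))%E.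
Proof.
rewrite /L2dist.
have [i1 v1] := @alt_sqr_int R d n Q d0 isT gam u.
have := integrable_fin_num (@measurable_ptcube R d) i1.
move=> /fineK <-; rewrite poweR_EFin lee_fin powR12_sqrt; last first.
  by rewrite fine_ge0// integral_ge0// => x _; rewrite lee_fin sqr_ge0.
rewrite -[X in X * _](ger0_norm gam_ge0) -sqrtr_sqr -sqrtrM ?sqr_ge0//.
apply: ler_wsqrtr; rewrite [leRHS]v1.
set a := 16^-1 ^+ Q ^+ 2 / 8.
apply: (@le_trans _ _ (\sum_(k : cell) gam ^+ 2 * (a / n%:R) ^+ d)).
  rewrite sumr_const card_ffun !card_ord -[leRHS]mulr_natl natrX (expr_div_n a n%:R).
  by rewrite mulrCA [X in _ <= _ * X]mulrC divfK// expf_neq0// pnatr_eq0 -lt0n.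
apply: ler_sum => k _; rewrite -[u k ^+ 2]real_normK ?num_real// u1 expr1n mul1r.
by rewrite ler_wpM2l ?sqr_ge0// cellint_ge.
Qed.

End one_alternative.

(** Here m gam^2 int h_k^2 <= (c1 B^d)^2 n^(-d/2), by the choice of gam and the
calibration of [n] against [m]. Squared and summed over the n^d cells, this is
at most (c1 B^d)^4, a small constant. *)
Lemma alt_chi2 (m : nat) : m%:R <= n%:R `^ (2 * s) * n%:R `^ (d%:R / 2) :> R ->
  \sum_(e : {ffun cell -> bool}) \sum_(e' : {ffun cell -> bool})
    (\int[nu R d]_(x in @ptcube R d)
      (alt Q gam (fun k => rsign R (e k)) (vec x) *
       alt Q gam (fun k => rsign R (e' k)) (vec x))) ^+ m <=
  5 / 4 * #|{ffun cell -> bool}|%:R ^+ 2.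
Proof.
move=> mn; have n1 : 0 < n%:R :> R by rewrite ltr0n.
pose tau (k : cell) := gam ^+ 2 * cellint R Q k.
pose x : R := (c1 * B ^+ d) ^+ 2 * n%:R `^ (- (d%:R / 2)).
have cb2 : (c1 * B ^+ d) ^+ 2 <= 4^-1.
  rewrite (_ : 4^-1 = 2^-1 ^+ 2); last by field.
  by rewrite lerXn2r// nnegrE; lra.
have cellint_ge0 k : 0 <= cellint R Q k.
  by apply: Rintegral_ge0 => y _; exact: sqr_ge0.
have tau_le k : 0 <= m%:R * tau k <= x.
  rewrite /tau; apply/andP; split.
    by rewrite mulr_ge0// mulr_ge0// sqr_ge0.
  apply: (@le_trans _ _ (n%:R `^ (2 * s) * n%:R `^ (d%:R / 2) *
     (gam ^+ 2 * (B ^+ 2 / n%:R) ^+ d))).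
    apply: ler_pM => //; first by rewrite mulr_ge0// sqr_ge0.
    rewrite ler_wpM2l ?sqr_ge0//.
    by apply: cellint_le => // t; exact: BB.
  rewrite /x exprMn expr_div_n exprMn.
  have -> : n%:R `^ (- s) ^+ 2 = (n%:R `^ (2 * s))^-1 :> R.
    by rewrite powRN exprVn -powR_mulrn ?powR_ge0// -powRrM [s * _]mulrC.
  have -> : n%:R ^+ d = n%:R `^ (d%:R / 2) * n%:R `^ (d%:R / 2) :> R.
    rewrite -powRD ?(gt_eqF n1) ?implybT// -powR_mulrn ?ler0n//.
    by congr (_ `^ _); field.
  have y0 : n%:R `^ (2 * s) != 0 :> R by rewrite gt_eqF// powR_gt0.
  have z0 : n%:R `^ (d%:R / 2) != 0 :> R by rewrite gt_eqF// powR_gt0.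
  rewrite powRN le_eqVlt; apply/orP; left; apply/eqP.
  by field; rewrite y0 z0.
have x_le : x <= 2^-1.
  have h : n%:R `^ (- (d%:R / 2)) <= 1 :> R.
    rewrite -[leRHS](powRr0 n%:R); apply: ler_powR; first by rewrite (ler_nat _ 1).
    by rewrite lerNl oppr0 divr_ge0.
  have h0 : 0 <= n%:R `^ (- (d%:R / 2)) :> R by exact: powR_ge0.
  rewrite /x; have := sqr_ge0 (c1 * B ^+ d); nra.
under eq_bigr do under eq_bigr do rewrite alt_mul_int//.
apply: (@rademacher_second_moment R {ffun 'I_d -> 'I_n} (fun k => m%:R * tau k)
  x tau_le x_le m tau (fun _ => erefl)).
- move=> e e'; rewrite -alt_mul_int//; apply: Rintegral_ge0 => y _.
  have /andP[h1 _] := @alt_bounds (fun k => rsign R (e k))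
    (fun k => normr_rsign R (e k)) (vec y).
  have /andP[h2 _] := @alt_bounds (fun k => rsign R (e' k))
    (fun k => normr_rsign R (e' k)) (vec y).
  exact: mulr_ge0.
- rewrite card_ffun !card_ord natrX /x exprMn.
  have -> : n%:R `^ (- (d%:R / 2)) ^+ 2 = (n%:R ^+ d)^-1 :> R.
    rewrite -powR_mulrn ?powR_ge0// -powRrM mulNr powRN.
    by rewrite divfK ?pnatr_eq0// powR_mulrn ?ler0n.
  rewrite (_ : _ * _ = 2 * ((c1 * B ^+ d) ^+ 2) ^+ 2); last first.
    by field; rewrite expf_neq0// gt_eqF.
  have := sqr_ge0 (c1 * B ^+ d); nra.
Qed.

End alternatives.

Theorem theorem1 (R : realType) (d : nat) (s L : R)
    (d_gt0 : (0 < d)%N) (s_gt0 : 0 < s) (L_gt1 : 1 < L) :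
  exists2 c : R, 0 < c &
    forall (m : nat) (eps : R), (0 < m)%N -> 0 < eps ->
      eps <= c * m%:R `^ (- (2 * s / (4 * s + d%:R))) ->
      ((2^-1)%:E <= minimax_risk m (@holder R d s L) eps)%E.
Proof.
set Q := (sfloor s).+4.
have [B B1 BB] := @bump_bounded R Q.
(* The amplitude has two upper bounds: the derivatives must stay below 1 < L, and
   the values of the alternative below L. *)
pose D : R := 2 * d%:R ^+ (sfloor s).+1 * B ^+ d.
have d1 : 1 <= d%:R ^+ (sfloor s).+1 :> R by rewrite exprn_ege1// (ler_nat _ 1).
have BD : 0 < B ^+ d by rewrite exprn_gt0//; lra.
have D0 : 0 < D by rewrite !mulr_gt0//; lra.
pose c1 : R := Num.min 1 (L - 1) / D.
have c10 : 0 < c1 by rewrite divr_gt0// lt_min ltr01 subr_gt0.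
have c1D : c1 * D = Num.min 1 (L - 1) by rewrite divfK// gt_eqF.
have hc1 : 2 * d%:R ^+ (sfloor s).+1 * c1 * B ^+ d <= 1.
  have -> : 2 * d%:R ^+ (sfloor s).+1 * c1 * B ^+ d = c1 * D.
    by rewrite /D; ring.
  by rewrite c1D ge_min lexx.
have hc2 : c1 * B ^+ d <= L - 1.
  apply: (@le_trans _ _ (c1 * D)); last by rewrite c1D ge_min lexx orbT.
  rewrite ler_wpM2l ?(ltW c10)// /D ler_peMl//; [exact: ltW|lra].
pose a : R := Num.sqrt ((16^-1 ^+ Q ^+ 2 / 8) ^+ d).
have a0 : 0 < a by rewrite sqrtr_gt0 exprn_gt0// divr_gt0// !exprn_gt0.
(* The factor 2^-s pays for rounding up the number of cells. *)
exists (c1 * a * 2 `^ (- s)) => [|m eps m0 eps0 hm].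
  by rewrite mulr_gt0 ?powR_gt0// mulr_gt0.
have [n n0 [mn nm]] := grid_calibration d_gt0 s_gt0 m0.
apply: le_ereal_inf_tmp => _ [phi [mphi phi01] <-].
have mC := @measurable_ptcube R d.
pose f (e : {ffun {ffun 'I_d -> 'I_n} -> bool}) (x : d.-tuple (measurableTypeR R)) :=
  alt Q (c1 * n%:R `^ (- s)) (fun k => rsign R (e k)) (vec x).
have sg1 (e : {ffun {ffun 'I_d -> 'I_n} -> bool}) k : `|rsign R (e k)| = 1.
  exact: normr_rsign.
have fm e : measurable_fun (@ptcube R d) (f e).
  exact: (@alt_measurable _ _ _ s c1 d_gt0 (fun k => rsign R (e k))).
have fb e x : ptcube x -> 0 <= f e x <= 2.
  by move=> _; exact: (alt_bounds d_gt0 n0 s_gt0 B1 c10 BB hc1 (sg1 e) (vec x)).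
have f1 e : \int[nu R d]_(x in @ptcube R d) f e x = 1.
  by have [] := @alt_int R d n Q d_gt0 isT (c1 * n%:R `^ (- s))
    (fun k => rsign R (e k)).
have chi2 := alt_chi2 d_gt0 n0 s_gt0 B1 c10 BB hc1 mn.
have [e he] := @mixture_second_moment _ _ R (nu R d) _ mC (nu_ptcube R d) _
  [ffun=> true] f 2 m phi fm fb f1 chi2 mphi phi01.
apply: (le_trans he); rewrite /risk; apply: leeD.
  rewrite le_eqVlt; apply/orP; left; apply/eqP; rewrite /expect.
  by apply: eq_integral => x _; rewrite /f0 big1 ?mulr1.
apply: ereal_sup_ubound.
exists (alt Q (c1 * n%:R `^ (- s)) (fun k => rsign R (e k))) => //; split.
- exact: (alt_holder d_gt0 n0 s_gt0 L_gt1 B1 c10 BB hc1 hc2 (sg1 e)).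
- exact: (alt_density d_gt0 n0 s_gt0 B1 c10 BB hc1 (sg1 e)).
- apply: le_trans (alt_separated s d_gt0 n0 c10 (sg1 e)); rewrite lee_fin -/a.
  apply: (le_trans hm).
  apply: (@le_trans _ _ (c1 * a * 2 `^ (- s) * (2 `^ s * n%:R `^ (- s)))).
    by rewrite ler_wpM2l// mulr_ge0 ?powR_ge0// mulr_ge0 ?(ltW c10) ?(ltW a0).
  have s2 : 2 `^ (- s) * 2 `^ s = 1 :> R.
    by rewrite powRN mulVf// gt_eqF// powR_gt0.
  by rewrite -mulrA (mulrA (2 `^ (- s))) s2 mul1r mulrAC.
Qed.
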